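(* Let $S$ and $S'$ be basic formal matrix rings of orders $n$ and $n'$ with Nakayama permutations $\sigma\in S_n$ and $\sigma'\in S_{n'}$, and with local corner rings $S_1,\dots,S_n$ and $S'_1,\dots,S'_{n'}$, respectively. Let $\pi$ be the concatenation of $\sigma$ and $\sigma'$. Further, assume that (A) all residue skew fields of local corner rings of $S$ are isomorphic to a fixed skew field $K$; (A') all residue skew fields of local corner rings of $S'$ are isomorphic to a fixed skew field $L$; (B) the skew fields $K$ and $L$ are compatible; (C) for any $i\le n$, the simple submodules $T_{\sigma(i)}$ and $T'_i$ of the pairing coordinate bimodule of $S$ at position $(i,\sigma(i))$ coincide, and $T'_i$ is isomorphic to $K$ as an $S_i$-$S_{\sigma(i)}$-bimodule; (C') for any $i\le n'$, the simple submodules $T_{\sigma'(i)}$ and $T'_i$ of the pairing coordinate bimodule of $S'$ at position $(i,\sigma'(i))$ coincide, and $T'_i$ is isomorphic to $L$ as an $S'_i$-$S'_{\sigma'(i)}$-bimodule; (D) for any fixed point $i$ of $\sigma$, the local corner $S_i$ is not simple; (D') for any fixed point $i$ of $\sigma'$, the local corner $S'_i$ is not simple. Then there exists an indecomposable basic ring $R$ of order $n+n'$ with a Nakayama permutation $\pi$ and an idempotent $f\in R$ such that $fRf\cong S$ and $(1-f)R(1-f)\cong S'$ as rings.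
   Context: Rings are associative and unital; $J(R)$ is the Jacobson radical; $S_n$ is the symmetric group on $\{1,\dots,n\}$. Formal matrix ring of order $n$: given local rings $R_1,\dots,R_n$ (local corners), $R_i$-$R_j$-bimodules $B_{i,j}$ (coordinate bimodules) with $B_{i,i}=R_i$, and $R_i$-$R_k$-bimodule homomorphisms $\varphi_{i,j,k}\colon B_{i,j}\otimes_{R_j}B_{j,k}\to B_{i,k}$, written $ab:=\varphi_{i,j,k}(a\otimes b)$, where $\varphi_{i,i,j}$ and $\varphi_{i,j,j}$ are the bimodule actions and $(ab)c=a(bc)$ for all $a\in B_{i,j}$, $b\in B_{j,k}$, $c\in B_{k,l}$. The ring $R$ is the set of $n\times n$ matrices whose $(i,j)$ entry lies in $B_{i,j}$, with the usual matrix addition and multiplication. The canonical idempotent $e_i$ is the matrix with $1_{R_i}$ at position $(i,i)$ and zeros elsewhere. $R$ is basic if the right modules $e_1R,\dots,e_nR$ are pairwise non-isomorphic; ''basic ring of order $n+n'$'' means basic formal matrix ring of order $n+n'$. The residue skew field of a local ring $R_i$ is $R_i/J(R_i)$. A ring is indecomposable if it is not a direct product of two nonzero rings. Nakayama permutation: a basic formal matrix ring $R$ of order $n$ is a ring with a Nakayama permutation $\pi\in S_n$ if for each $i\le n$ one has $soc(e_iR)\cong top(e_{\pi(i)}R)$ as right $R$-modules and $soc(Re_{\pi(i)})\cong top(Re_i)$ as left $R$-modules, where $top(M)=M/MJ(R)$ (resp. $M/J(R)M$). Then $B_{i,\pi(i)}$ is called a pairing coordinate bimodule. $T_{\pi(i)}$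 denotes the socle, as a right $R_{\pi(i)}$-module, of $\{m\in B_{i,\pi(i)} : mB_{\pi(i),j}=0\text{ for all }j\neq\pi(i)\}$, and $T'_i$ denotes the socle, as a left $R_i$-module, of $\{m\in B_{i,\pi(i)} : B_{h,i}m=0\text{ for all }h\neq i\}$; these are simple one-sided modules. This notation is used for $S$ with $\sigma$ and for $S'$ with $\sigma'$. Two skew fields $K$ and $L$ are compatible if $K$ admits a $K$-$L$-bimodule structure and $L$ admits an $L$-$K$-bimodule structure (where the left action of $K$ on $K$, resp. of $L$ on $L$, is by multiplication). In (C), $K$ is a bimodule over $S_i$ and $S_{\sigma(i)}$ via the canonical projections onto the residue skew fields followed by fixed isomorphisms with $K$ as in (A); similarly for $L$ in (C'). Concatenation: view $\sigma\in S_n$ and $\sigma'\in S_{n'}$ as elements of $S_{n+n'}$ fixing the extra elements, and let $\tau_n\in S_{n+n'}$ be $i\mapsto i+n \pmod{n+n'}$. The concatenation of $\sigma$ and $\sigma'$ is $\sigma\circ(\tau_n\circ\sigma'\circ\tau_n^{-1})\in S_{n+n'}$; i.e. it acts as $\sigma$ on $\{1,\dots,n\}$ and as $n+i\mapsto n+\sigma'(i)$ on $\{n+1,\dots,n+n'\}$. *)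

(* Defs.v *)
From HB Require Import structures.
From mathcomp Require Import all_boot all_order all_fingroup all_algebra.
From mathcomp Require Import generic_quotient ring_quotient boolp.

Set Implicit Arguments.
Unset Strict Implicit.
Unset Printing Implicit Defensive.

Import GRing.Theory.
Local Open Scope ring_scope.
Local Open Scope quotient_scope.

(* Only left modules are developed: a right module over A is a left module over
   the converse ring A^c. *)

Section Submodules.
Variables (A : pzRingType) (V : lmodType A).
Implicit Types N P X : {pred V}.

Definition span (G : V -> Prop) : {pred V} :=
  fun x => `[< forall P, submod_closed P -> (forall y, G y -> y \in P) ->
               x \in P >].

Lemma span_closed G : submod_closed (span G).
Proof.
split=> [|a x y]; first by apply/asboolP => P [].
move=> /asboolP hx /asboolP hy; apply/asboolP => P cP GP.
by case: (cP) => _; apply; [exact: hx | exact: hy].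
Qed.

HB.instance Definition _ G := GRing.isSubmodClosed.Build A V (span G)
  (span_closed G).

Definition simple_submod N : Prop :=
  [/\ submod_closed N, exists2 x, x \in N & x != 0 &
      forall P, submod_closed P -> {subset P <= N} ->
        (forall x, x \in P -> x = 0) \/ {subset N <= P}].

Definition soc X : submodClosed V :=
  span (fun x => exists N, [/\ simple_submod N, {subset N <= X} & x \in N]).

(* The submodule JX generated by the products of elements of J and X. *)
Definition ideal_act (J : {pred A}) X : submodClosed V :=
  span (fun x => exists j v, [/\ j \in J, v \in X & x = j *: v]).

Definition submod_type (X : submodClosed V) : Type := {x : V | x \in X}.
Variable X : submodClosed V.
HB.instance Definition _ := Choice.on (submod_type X).
HB.instance Definition _ := SubType.on (submod_type X).
HB.instance Definition _ := [SubChoice_isSubLmodule of submod_type X by <:].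

End Submodules.

Section QuotientModule.
Variables (A : pzRingType) (V : lmodType A) (Y : submodClosed V).

(* submodClosed only records closure under + and *:, hence this copy of Y as a
   subgroup. *)
Definition submod_pred : {pred V} := fun x => x \in Y.
HB.instance Definition _ := GRing.isZmodClosed.Build V submod_pred
  (GRing.submod_closedB (submodClosedP Y)).

Definition quot_mod : Type := Quotient.quot submod_pred.
HB.instance Definition _ := GRing.Zmodule.on quot_mod.

Definition quot_proj (x : V) : quot_mod := \pi_(Quotient.quot submod_pred) x.

Lemma quot_projE x y : (quot_proj x = quot_proj y) <-> (x - y \in Y).
Proof.
rewrite -[x - y \in Y]/(x - y \in submod_pred) Quotient.idealrBE.
by split=> [/eqP|/eqP].
Qed.

Lemma quot_projD : {morph quot_proj : x y / x + y}.
Proof. exact: (raddfD (\pi_(Quotient.quot submod_pred))). Qed.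

Lemma quot_projK : cancel (fun u : quot_mod => repr u) quot_proj.
Proof. by move=> u; rewrite /quot_proj reprK. Qed.

Definition quot_scale (a : A) (u : quot_mod) : quot_mod :=
  quot_proj (a *: (repr u : V)).

Lemma quot_projZ a x : quot_proj (a *: x) = quot_scale a (quot_proj x).
Proof.
apply/quot_projE; rewrite -scalerBr; apply: rpredZ.
by apply/quot_projE; rewrite quot_projK.
Qed.

Lemma quot_scaleA a b u : quot_scale a (quot_scale b u) = quot_scale (a * b) u.
Proof. by rewrite -[u]quot_projK -!quot_projZ scalerA. Qed.

Lemma quot_scale1 : left_id 1 quot_scale.
Proof. by move=> u; rewrite -[u]quot_projK -quot_projZ scale1r. Qed.

Lemma quot_scaleDr : right_distributive quot_scale +%R.
Proof.
move=> a u v; rewrite -[u]quot_projK -[v]quot_projK.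
by rewrite -quot_projD -!quot_projZ scalerDr quot_projD.
Qed.

Lemma quot_scaleDl u : {morph quot_scale^~ u : a b / a + b}.
Proof.
by move=> a b /=; rewrite -[u]quot_projK -!quot_projZ scalerDl quot_projD.
Qed.

HB.instance Definition _ := GRing.Zmodule_isLmodule.Build A quot_mod
  quot_scaleA quot_scale1 quot_scaleDr quot_scaleDl.

End QuotientModule.

Definition lmod_iso (A : pzRingType) (U V : lmodType A) : Prop :=
  exists f : {linear U -> V}, bijective f.

Definition ring_iso (A B : pzRingType) : Prop :=
  exists f : {rmorphism A -> B}, bijective f.

Section Radical.
Variable A : pzRingType.

Definition max_left_ideal (M : {pred A}) : Prop :=
  [/\ submod_closed (M : {pred A^o}), 1 \notin M &
      forall L : {pred A}, submod_closed (L : {pred A^o}) ->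
        {subset M <= L} -> 1 \notin L -> {subset L <= M}].

Definition jacobson : {pred A} :=
  fun x => `[< forall M, max_left_ideal M -> x \in M >].

Definition local_ring : Prop :=
  exists2 M, max_left_ideal M & forall M', max_left_ideal M' -> M' =i M.

Definition two_sided_ideal (I : {pred A}) : Prop :=
  [/\ zmod_closed I, forall a x, x \in I -> a * x \in I &
      forall a x, x \in I -> x * a \in I].

Definition simple_ring : Prop :=
  (1 : A) != 0 /\
  forall I, two_sided_ideal I -> (forall x, x \in I -> x = 0) \/ 1 \in I.

Lemma jacobson_zmod_closed : zmod_closed jacobson.
Proof.
split=> [|x y /asboolP hx /asboolP hy]; apply/asboolP => M hM.
  by case: (hM) => -[].
case: (hM) => cM _ _; move: (GRing.submod_closedB cM) => [_]; apply.
- exact: hx.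
- exact: hy.
Qed.

HB.instance Definition _ := GRing.isZmodClosed.Build A jacobson
  jacobson_zmod_closed.

Lemma jacobsonMl a x : x \in jacobson -> a * x \in jacobson.
Proof.
move=> /asboolP hx; apply/asboolP => M hM; case: (hM) => -[M0 cM] _ _.
by have := cM a x 0 (hx _ hM) M0; rewrite addr0.
Qed.

Lemma jacobsonMr a x : x \in jacobson -> x * a \in jacobson.
Proof.
move=> /asboolP hx; apply/asboolP => M hM; case: (hM) => -[M0 cM] M1 maxM.
have M_mul r y : y \in M -> r * y \in M.
  by move=> My; have := cM r y 0 My M0; rewrite addr0.
have [aM|aM] := boolP (a \in M); first exact: M_mul.
pose C : {pred A} := fun y => y * a \in M.
suff hC : max_left_ideal C by exact: (hx C hC).
split.
- split=> [|r y z]; first by rewrite unfold_in /= mul0r.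
  rewrite !unfold_in => hy hz.
  by rewrite mulrDl -[_ *: _]/(r * y) -mulrA; exact: cM.
- by rewrite unfold_in mul1r.
- move=> L [L0 cL] CL L1 y Ly; rewrite unfold_in; apply: contraNT L1 => yM.
  pose Q : {pred A} := fun z =>
    `[< exists2 m, m \in M & exists r, z = m + r * (y * a) >].
  have cQ : submod_closed (Q : {pred A^o}).
    split; first by apply/asboolP; exists 0 => //; exists 0; rewrite mul0r addr0.
    move=> r z1 z2 /asboolP[m1 hm1 [r1 ->]] /asboolP[m2 hm2 [r2 ->]].
    apply/asboolP; exists (r *: (m1 : A^o) + m2); first exact: cM.
    exists (r * r1 + r2); rewrite -![_ *: _]/(_ * _).
    by rewrite mulrDr mulrDl !mulrA addrACA.
  have MQ : {subset M <= Q}.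
    by move=> m hm; apply/asboolP; exists m => //; exists 0; rewrite mul0r addr0.
  have yQ : y * a \in Q.
    by apply/asboolP; exists 0 => //; exists 1; rewrite mul1r add0r.
  have [Q1|Q1] := boolP (1 \in Q); last first.
    by move: yM; rewrite (maxM Q cQ MQ Q1 _ yQ).
  have /asboolP[m hm [r ar]] : a \in Q.
    have := cQ.2 a 1 0 Q1 cQ.1.
    by rewrite addr0 -[_ *: _]/(a * 1) mulr1.
  have hC : 1 - r * y \in C.
    by rewrite unfold_in mulrBl mul1r -mulrA {1}ar addrK.
  have := cL r y (1 - r * y) Ly (CL _ hC).
  by rewrite -[_ *: _]/(r * y) addrC subrK.
Qed.

End Radical.
Arguments jacobson A : clear implicits.

(* The ring A / J(A); the library only has quotients of commutative rings. *)
Section ResidueRing.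
Variable A : pzRingType.

Definition residue : Type := Quotient.quot (jacobson A).
HB.instance Definition _ := GRing.Zmodule.on residue.

Definition residue_proj (x : A) : residue :=
  \pi_(Quotient.quot (jacobson A)) x.

Lemma residue_projE x y :
  (residue_proj x = residue_proj y) <-> (x - y \in jacobson A).
Proof. by rewrite Quotient.idealrBE; split=> [/eqP|/eqP]. Qed.

Lemma residue_projD : {morph residue_proj : x y / x + y}.
Proof. exact: (raddfD (\pi_(Quotient.quot (jacobson A)))). Qed.

Lemma residue_projK : cancel (fun u : residue => repr u) residue_proj.
Proof. by move=> u; rewrite /residue_proj reprK. Qed.

Definition residue_mul (u v : residue) : residue :=
  residue_proj ((repr u : A) * (repr v : A)).

Lemma residue_projM : {morph residue_proj : x y / x * y >-> residue_mul x y}.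
Proof.
move=> x y; apply/residue_projE.
set x' := repr _; set y' := repr _.
have hx : x - x' \in jacobson A by apply/residue_projE; rewrite residue_projK.
have hy : y - y' \in jacobson A by apply/residue_projE; rewrite residue_projK.
have -> : x * y - x' * y' = x * (y - y') + (x - x') * y'.
  by rewrite mulrBr mulrBl addrA subrK.
by apply: rpredD; [exact: jacobsonMl | exact: jacobsonMr].
Qed.

Lemma residue_mulA : associative residue_mul.
Proof.
move=> u v w; rewrite -[u]residue_projK -[v]residue_projK -[w]residue_projK.
by rewrite -!residue_projM mulrA.
Qed.

Lemma residue_mul1 : left_id (residue_proj 1) residue_mul.
Proof. by move=> u; rewrite -[u]residue_projK -residue_projM mul1r. Qed.

Lemma residue_1mul : right_id (residue_proj 1) residue_mul.
Proof. by move=> u; rewrite -[u]residue_projK -residue_projM mulr1. Qed.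

Lemma residue_mulDl : left_distributive residue_mul +%R.
Proof.
move=> u v w; rewrite -[u]residue_projK -[v]residue_projK -[w]residue_projK.
by rewrite -residue_projD -!residue_projM mulrDl residue_projD.
Qed.

Lemma residue_mulDr : right_distributive residue_mul +%R.
Proof.
move=> u v w; rewrite -[u]residue_projK -[v]residue_projK -[w]residue_projK.
by rewrite -residue_projD -!residue_projM mulrDr residue_projD.
Qed.

HB.instance Definition _ := GRing.Zmodule_isPzRing.Build residue
  residue_mulA residue_mul1 residue_1mul residue_mulDl residue_mulDr.

End ResidueRing.

Definition indecomposable_ring (A : pzRingType) : Prop :=
  ~ exists B C : nzRingType, ring_iso A (B * C)%type.

(* The ring f A f, with unit f. *)
Section CornerRing.
Variables (A : pzRingType) (f : A).

Definition peirce : {pred A} := fun x => `[< exists r, x = f * r * f >].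

Lemma peirce_zmod_closed : zmod_closed peirce.
Proof.
split; first by apply/asboolP; exists 0; rewrite mulr0 mul0r.
move=> x y /asboolP[r ->] /asboolP[s ->]; apply/asboolP; exists (r - s).
by rewrite mulrBr mulrBl.
Qed.

HB.instance Definition _ := GRing.isZmodClosed.Build A peirce
  peirce_zmod_closed.

Hypothesis ff : f * f = f.

Definition corner_ring of f * f = f : Type := {x : A | x \in peirce}.
HB.instance Definition _ := Choice.on (corner_ring ff).
HB.instance Definition _ := SubType.on (corner_ring ff).
HB.instance Definition _ := [SubChoice_isSubZmodule of corner_ring ff by <:].

Lemma peirce_mul x y : x \in peirce -> y \in peirce -> x * y \in peirce.
Proof.
move=> /asboolP[r ->] /asboolP[s ->]; apply/asboolP; exists (r * f * f * s).
by rewrite !mulrA.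
Qed.

Lemma peirce_one : f \in peirce.
Proof. by apply/asboolP; exists f; rewrite !ff. Qed.

Lemma peirce_id x : x \in peirce -> f * x = x /\ x * f = x.
Proof. by move=> /asboolP[r ->]; rewrite !mulrA ff -!mulrA ff. Qed.

Definition corner_mul (x y : corner_ring ff) : corner_ring ff :=
  Sub (val x * val y) (peirce_mul (valP x) (valP y)).
Definition corner_one : corner_ring ff := Sub f peirce_one.

Lemma corner_mulA : associative corner_mul.
Proof. by move=> x y z; apply: val_inj; rewrite /= mulrA. Qed.
Lemma corner_mul1 : left_id corner_one corner_mul.
Proof. by move=> x; apply: val_inj; case: (peirce_id (valP x)). Qed.
Lemma corner_1mul : right_id corner_one corner_mul.
Proof. by move=> x; apply: val_inj; case: (peirce_id (valP x)). Qed.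
Lemma corner_mulDl : left_distributive corner_mul +%R.
Proof. by move=> x y z; apply: val_inj; rewrite /= mulrDl. Qed.
Lemma corner_mulDr : right_distributive corner_mul +%R.
Proof. by move=> x y z; apply: val_inj; rewrite /= mulrDr. Qed.

HB.instance Definition _ := GRing.Zmodule_isPzRing.Build (corner_ring ff)
  corner_mulA corner_mul1 corner_1mul corner_mulDl corner_mulDr.

Lemma idem_compl : (1 - f) * (1 - f) = 1 - f.
Proof. by rewrite mulrBr mulr1 mulrBl mul1r ff subrr subr0. Qed.

End CornerRing.

(* Coordinate bimodules B i j with products B i j x B j k -> B i k. The
   bimodule structures are the products fm_mul i i j and fm_mul i j j, so that
   fm_mulA also says that the products are balanced, i.e. factor through the
   tensor product over B j j, and that they are bimodule homomorphisms. *)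
Record formal_data (n : nat) := FormalData {
  fm_entry :> 'I_n -> 'I_n -> zmodType;
  fm_mul : forall i j k, fm_entry i j -> fm_entry j k -> fm_entry i k;
  fm_one : forall i, fm_entry i i;
  fm_mulDl : forall i j k (a b : fm_entry i j) (c : fm_entry j k),
    fm_mul (a + b) c = fm_mul a c + fm_mul b c;
  fm_mulDr : forall i j k (a : fm_entry i j) (b c : fm_entry j k),
    fm_mul a (b + c) = fm_mul a b + fm_mul a c;
  fm_mulA : forall i j k l (a : fm_entry i j) (b : fm_entry j k)
    (c : fm_entry k l), fm_mul (fm_mul a b) c = fm_mul a (fm_mul b c);
  fm_mul1l : forall i j (a : fm_entry i j), fm_mul (fm_one i) a = a;
  fm_mul1r : forall i j (a : fm_entry i j), fm_mul a (fm_one j) = a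
}.

Section FormalData.
Variables (n : nat) (F : formal_data n).
Implicit Types i j k : 'I_n.

Lemma fm_mul0l i j k (b : F j k) : fm_mul (0 : F i j) b = 0.
Proof. by apply: (addrI (fm_mul 0 b)); rewrite -fm_mulDl !addr0. Qed.

Lemma fm_mul0r i j k (a : F i j) : fm_mul a (0 : F j k) = 0.
Proof. by apply: (addrI (fm_mul a 0)); rewrite -fm_mulDr !addr0. Qed.

Lemma fm_mul_suml i j k (I : finType) (a : I -> F i j) (b : F j k) :
  fm_mul (\sum_x a x) b = \sum_x fm_mul (a x) b.
Proof.
apply: (big_morph (fun a => fm_mul a b)); last exact: fm_mul0l.
by move=> x y; rewrite fm_mulDl.
Qed.

Lemma fm_mul_sumr i j k (I : finType) (a : F i j) (b : I -> F j k) :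
  fm_mul a (\sum_x b x) = \sum_x fm_mul a (b x).
Proof.
apply: (big_morph (fm_mul a)); last exact: fm_mul0r.
by move=> x y; rewrite fm_mulDr.
Qed.

Definition fm_corner i : Type := F i i.
HB.instance Definition _ i := GRing.Zmodule.on (fm_corner i).
HB.instance Definition _ i := GRing.Zmodule_isPzRing.Build (fm_corner i)
  (fun a b c => esym (fm_mulA a b c)) (@fm_mul1l n F i i) (@fm_mul1r n F i i)
  (@fm_mulDl n F i i i) (@fm_mulDr n F i i i).

Definition fm_entryL i j : Type := F i j.
HB.instance Definition _ i j := GRing.Zmodule.on (fm_entryL i j).
HB.instance Definition _ i j :=
  GRing.Zmodule_isLmodule.Build (fm_corner i) (fm_entryL i j)
    (fun a b v => esym (fm_mulA a b v)) (@fm_mul1l n F i j)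
    (@fm_mulDr n F i i j) (fun v a b => fm_mulDl a b v).

Definition fm_entryR i j : Type := F i j.
HB.instance Definition _ i j := GRing.Zmodule.on (fm_entryR i j).
HB.instance Definition _ i j :=
  GRing.Zmodule_isLmodule.Build (fm_corner j)^c (fm_entryR i j)
    (fun a b v => fm_mulA v b a) (@fm_mul1r n F i j)
    (fun a u v => fm_mulDl u v a) (fun v a b => fm_mulDr v a b).

(* Indexed by pairs, so that the type inherits a choiceType structure. *)
Definition fm_matrix : Type := {dffun forall p : 'I_n * 'I_n, F p.1 p.2}.
HB.instance Definition _ := Choice.on fm_matrix.

Definition fmx_at (x : fm_matrix) i j : F i j := x (i, j).

Definition fmx (x : forall i j, F i j) : fm_matrix :=
  [ffun p => x p.1 p.2].

Lemma fmxE x i j : fmx_at (fmx x) i j = x i j.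
Proof. by rewrite /fmx_at ffunE. Qed.

Lemma fm_matrixP (x y : fm_matrix) :
  (forall i j, fmx_at x i j = fmx_at y i j) -> x = y.
Proof. by move=> h; apply/ffunP => -[i j]; exact: h. Qed.

Definition fmx_add (x y : fm_matrix) :=
  fmx (fun i j => fmx_at x i j + fmx_at y i j).
Definition fmx_opp (x : fm_matrix) := fmx (fun i j => - fmx_at x i j).

Lemma fmx_addA : associative fmx_add.
Proof. by move=> x y z; apply: fm_matrixP => i j; rewrite !fmxE addrA. Qed.
Lemma fmx_addC : commutative fmx_add.
Proof. by move=> x y; apply: fm_matrixP => i j; rewrite !fmxE addrC. Qed.
Lemma fmx_add0 : left_id (fmx (fun _ _ => 0)) fmx_add.
Proof. by move=> x; apply: fm_matrixP => i j; rewrite !fmxE add0r. Qed.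
Lemma fmx_addN : left_inverse (fmx (fun _ _ => 0)) fmx_opp fmx_add.
Proof. by move=> x; apply: fm_matrixP => i j; rewrite !fmxE addNr. Qed.

HB.instance Definition _ := GRing.isZmodule.Build fm_matrix
  fmx_addA fmx_addC fmx_add0 fmx_addN.

Definition fmx_mul (x y : fm_matrix) : fm_matrix :=
  fmx (fun i k => \sum_j fm_mul (fmx_at x i j) (fmx_at y j k)).

Definition fm_id j k : F j k :=
  if j =P k is ReflectT jk then ecast l (F j l) jk (fm_one F j) else 0.

Definition fmx_one : fm_matrix := fmx fm_id.

(* The canonical idempotent e_i. *)
Definition fmx_idem i : fm_matrix :=
  fmx (fun j k => if (j == i) && (k == i) then fm_id j k else 0).

Lemma fmx_addE (x y : fm_matrix) i j :
  fmx_at (x + y) i j = fmx_at x i j + fmx_at y i j.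
Proof. exact: fmxE. Qed.

Lemma fm_id_diag i : fm_id i i = fm_one F i.
Proof. by rewrite /fm_id; case: eqP => // ii; rewrite (eq_axiomK ii). Qed.

Lemma fm_id_off i j : i != j -> fm_id i j = 0.
Proof. by rewrite /fm_id; case: eqP. Qed.

Lemma fmx_mulA : associative fmx_mul.
Proof.
move=> x y z; apply: fm_matrixP => i l; rewrite !fmxE.
transitivity (\sum_j \sum_k fm_mul (fm_mul (fmx_at x i j) (fmx_at y j k)) (fmx_at z k l)).
  apply: eq_bigr => j _; rewrite fmxE fm_mul_sumr.
  by apply: eq_bigr => k _; rewrite fm_mulA.
rewrite exchange_big /=; apply: eq_bigr => k _.
by rewrite fmxE fm_mul_suml.
Qed.

Lemma fmx_mul1 : left_id fmx_one fmx_mul.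
Proof.
move=> x; apply: fm_matrixP => i k; rewrite fmxE (bigD1 i) //= big1.
  by rewrite addr0 fmxE fm_id_diag fm_mul1l.
by move=> j ji; rewrite fmxE fm_id_off ?fm_mul0l // eq_sym.
Qed.

Lemma fmx_1mul : right_id fmx_one fmx_mul.
Proof.
move=> x; apply: fm_matrixP => i k; rewrite fmxE (bigD1 k) //= big1.
  by rewrite addr0 fmxE fm_id_diag fm_mul1r.
by move=> j jk; rewrite fmxE fm_id_off ?fm_mul0r.
Qed.

Lemma fmx_mulDl : left_distributive fmx_mul +%R.
Proof.
move=> x y z; apply: fm_matrixP => i k; rewrite fmx_addE !fmxE -big_split /=.
by apply: eq_bigr => j _; rewrite fmx_addE fm_mulDl.
Qed.

Lemma fmx_mulDr : right_distributive fmx_mul +%R.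
Proof.
move=> x y z; apply: fm_matrixP => i k; rewrite fmx_addE !fmxE -big_split /=.
by apply: eq_bigr => j _; rewrite fmx_addE fm_mulDr.
Qed.

HB.instance Definition _ := GRing.Zmodule_isPzRing.Build fm_matrix
  fmx_mulA fmx_mul1 fmx_1mul fmx_mulDl fmx_mulDr.

End FormalData.

Record formal_matrix_ring (n : nat) := FormalMatrixRing {
  fm_data :> formal_data n;
  fm_local : forall i, local_ring (fm_corner fm_data i)
}.

Section PrincipalLeftIdeal.
Variables (A : pzRingType) (e : A).

Definition lprinc : {pred A^o} := fun x => `[< exists r, x = r * e >].

Lemma lprinc_closed : submod_closed lprinc.
Proof.
split; first by apply/asboolP; exists 0; rewrite mul0r.
move=> a x y /asboolP[r ->] /asboolP[s ->]; apply/asboolP; exists (a * r + s).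
by rewrite mulrDl -mulrA.
Qed.

HB.instance Definition _ := GRing.isSubmodClosed.Build A A^o lprinc
  lprinc_closed.
End PrincipalLeftIdeal.

(* The left R-modules R e, soc (R e) and top (R e), and the right R-modules
   e R, soc (e R) and top (e R). Note that e R is the left ideal of R^c
   generated by e, and that M J(R) = J(R) M for a left R^c-module M. *)
Section PrincipalModules.
Variables (R : pzRingType) (e : R).

Definition modL : lmodType R := submod_type (lprinc e).
Definition socL : lmodType R := submod_type (soc (lprinc e)).
Definition topL : lmodType R :=
  quot_mod (ideal_act (jacobson R) (predT : {pred modL})).

Definition modR : lmodType R^c := submod_type (lprinc (e : R^c)).
Definition socR : lmodType R^c := submod_type (soc (lprinc (e : R^c))).
Definition topR : lmodType R^c :=
  quot_mod (ideal_act (jacobson R : {pred R^c}) (predT : {pred modR})).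
End PrincipalModules.

Definition basic (n : nat) (F : formal_matrix_ring n) : Prop :=
  forall i j : 'I_n, i != j ->
    ~ lmod_iso (modR (fmx_idem F i)) (modR (fmx_idem F j)).

Definition nakayama_permutation (n : nat) (F : formal_matrix_ring n)
    (p : 'S_n) : Prop :=
  forall i : 'I_n,
    lmod_iso (socR (fmx_idem F i)) (topR (fmx_idem F (p i))) /\
    lmod_iso (socL (fmx_idem F (p i))) (topL (fmx_idem F i)).

Section PairingSocles.
Variables (n : nat) (F : formal_data n) (i j : 'I_n).

Definition right_annihilated : {pred F i j} :=
  fun m => `[< forall k, k != j -> forall b : F j k, fm_mul m b = 0 >].

Definition left_annihilated : {pred F i j} :=
  fun m => `[< forall h, h != i -> forall b : F h i, fm_mul b m = 0 >].

(* For j = p i, these are T_(p i) and T'_i. *)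
Definition pairing_socR : {pred F i j} :=
  soc (right_annihilated : {pred fm_entryR F i j}).
Definition pairing_socL : {pred F i j} :=
  soc (left_annihilated : {pred fm_entryL F i j}).
End PairingSocles.
Arguments right_annihilated {n} F i j.
Arguments left_annihilated {n} F i j.
Arguments pairing_socR {n} F i j.
Arguments pairing_socL {n} F i j.

Definition skew_field (K : unitRingType) : Prop :=
  forall x : K, x != 0 -> x \is a GRing.unit.

Definition is_bimodule (A B : pzRingType) (V : zmodType)
    (l : A -> V -> V) (r : V -> B -> V) : Prop :=
  [/\ [/\ forall a b v, l (a * b) v = l a (l b v), forall v, l 1 v = v,
          forall a u v, l a (u + v) = l a u + l a v &
          forall a b v, l (a + b) v = l a v + l b v],
      [/\ forall v a b, r v (a * b) = r (r v a) b, forall v, r v 1 = v,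
          forall u v a, r (u + v) a = r u a + r v a &
          forall v a b, r v (a + b) = r v a + r v b] &
      forall a v b, l a (r v b) = r (l a v) b].

Definition compatible (K L : unitRingType) : Prop :=
  (exists r : K -> L -> K, is_bimodule (fun k x : K => k * x) r) /\
  (exists r : L -> K -> L, is_bimodule (fun l x : L => l * x) r).

(* The subset T of B i j is (a subbimodule) isomorphic, as a bimodule, to K on
   which the corners i and j act through phi and psi. *)
Definition residue_bimodule_iso (n : nat) (F : formal_data n) (i j : 'I_n)
    (T : {pred F i j}) (K : unitRingType)
    (phi : residue (fm_corner F i) -> K) (psi : residue (fm_corner F j) -> K) :
    Prop :=
  exists g : K -> F i j,
    [/\ injective g, {morph g : x y / x + y},
        forall m, (m \in T) <-> (exists x, m = g x),
        forall (s : fm_corner F i) x,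
          g (phi (residue_proj s) * x) = fm_mul (s : F i i) (g x) &
        forall x (t : fm_corner F j),
          g (x * psi (residue_proj t)) = fm_mul (g x) (t : F j j)].

Section Concatenation.
Variables (m n : nat) (s : 'S_m) (t : 'S_n).

Definition concat_fun (k : 'I_(m + n)) : 'I_(m + n) :=
  match split k with
  | inl i => lshift n (s i)
  | inr j => rshift m (t j)
  end.

Lemma concat_fun_inj : injective concat_fun.
Proof.
apply: (can_inj (g := fun k : 'I_(m + n) => match split k with
  | inl i => lshift n ((s^-1)%g i) | inr j => rshift m ((t^-1)%g j) end)).
move=> k; rewrite /concat_fun -{2}[k]splitK.
case: (split k) => i.
  by rewrite -[lshift n (s i)]/(unsplit (inl (s i))) unsplitK permK.
by rewrite -[rshift m (t i)]/(unsplit (inr (t i))) unsplitK permK.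
Qed.

Definition concatenation : 'S_(m + n) := perm concat_fun_inj.
End Concatenation.

(* Main.v *)
Require Import Defs.
From HB Require Import structures.
From mathcomp Require Import all_boot all_order all_fingroup all_algebra.
From mathcomp Require Import generic_quotient boolp classical_sets.

(** The ring R is a two by two block ring with S and S' on the diagonal. Every
    entry of the upper right block is one and the same K-L-bimodule U, every
    entry of the lower left block one and the same L-K-bimodule V, and S and S'
    act on them through their residue skew fields. A product u v of an entry of
    U and an entry of V, in row i and column sigma i, is the value of a pairing
    of U and V with values in K, placed into the simple socle of the pairing
    bimodule of S at (i, sigma i), which is a copy of K; in the other columns
    u v = 0. The products v u are defined in the same way by a pairing of V and
    U with values in L.

    Two families of maps make associativity a computation without cases on the
    indices ([gl_mulA]). The residue maps, extended by 0 to the entries off the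
    diagonal, are multiplicative because S is basic ([ext_residueM]). The
    embeddings of K into the socles, extended by 0 to the positions other than
    (i, sigma i), are bilinear along the residue maps, and the residue maps
    kill their images because a corner fixed by sigma is not simple
    ([ext_residue_socle]). So u v u' vanishes in both bracketings, and all
    other cases are the linearity and the balance of the pairings.

    The Nakayama condition becomes a condition on entries: the radical of a
    formal matrix ring is the set of matrices with all entries in the radical
    of the category formed by the entries ([jacobson_fmxP]), and
    soc(e_i R) is isomorphic to top(e_p R) if and only if a single nonzero
    element t at (i, p) that is killed by the radical generates all elements of
    row i that are killed by the radical ([right_soc_top], [left_soc_top]). In
    R the old generators t still have this property as soon as no nonzero
    element of U or V is orthogonal to everything, on either side of either
    pairing ([gl_right_pairedP], [gl_left_pairedP]).

    It remains to find U and V with such pairings ([dual_pair]). Let X be a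
    nonzero K-L-bimodule. Iterate the left dual Hom_K(X, K),
    Hom_L(Hom_K(X, K), L) and so on to the right of X, and the duals formed of
    right linear functionals to the left of X. In the resulting chain, infinite
    in both directions, K-L-bimodules and L-K-bimodules alternate, and every
    member is paired with both its neighbours by evaluation, nondegenerately
    because functionals separate the points of a vector space. The direct sums
    of the members of either kind are U and V.

    Finally, R is indecomposable because a central idempotent is diagonal with
    entries 0 or 1, and the nonzero elements of U force these entries to be
    equal ([connected_indecomposable]). *)

Set Implicit Arguments.
Unset Strict Implicit.
Unset Printing Implicit Defensive.

Import GRing.Theory.
Local Open Scope ring_scope.

(** * Maximal submodules, the radical and local rings *)

(** Zorn's lemma in the one form that is needed: with v = 1 in a ring it gives
    maximal left ideals, with N = 0 in a vector space it gives a hyperplane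
    that misses v. *)
Lemma max_submod (A : pzRingType) (V : lmodType A) (N : {pred V}) (v : V) :
  submod_closed N -> v \notin N ->
  exists P : {pred V}, [/\ submod_closed P, {subset N <= P}, v \notin P &
    forall Q : {pred V}, submod_closed Q -> {subset P <= Q} -> v \notin Q ->
      {subset Q <= P}].
Proof.
move=> cN vN; pose good (X : set V) := [/\ submod_closed (fun x => `[< X x >]),
  forall x, x \in N -> X x & ~ X v].
(* The empty set is admitted so that the empty chain has an upper bound. *)
have [F FP totF|X [[X0|[cX NX vX]] maxX]] :=
  @Zorn_bigcup V (fun X => X = set0 \/ good X).
- have [[X FX gX]|noX] := pselect (exists2 X, F X & good X); last first.
    left; apply/seteqP; split=> // x [X FX Xx].
    by case: (FP X FX) => [X0|gX]; [rewrite X0 in Xx | case: noX; exists X].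
  right; split=> [|x Nx|[Y FY Yv]].
  + split; first by apply/asboolP; exists X => //; case: gX => -[/asboolP].
    move=> a x y /asboolP[Y FY Yx] /asboolP[Z FZ Zy]; apply/asboolP.
    wlog : / exists W, [/\ F W, W x & W y].
      move=> h; case: (totF Y Z FY FZ) => [YZ|ZY]; apply: h.
      + by exists Z; split => //; exact: YZ.
      + by exists Y; split => //; exact: ZY.
    move=> [W [FW Wx Wy]]; exists W => //.
    case: (FP W FW) => [W0|[[_ cW] _ _]]; first by rewrite W0 in Wx.
    by apply/asboolP; apply: cW; apply/asboolP.
  + by exists X => //; case: gX => _ /(_ _ Nx).
  + by case: (FP Y FY) => [Y0|[_ _]]; [rewrite Y0 in Yv | apply].
- case: (maxX [set x | x \in N]%classic); last first.
    right; split => //; last by move=> Nv; rewrite Nv in vN.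
    have -> // : (fun x => `[< [set x | x \in N]%classic x >]) = N :> (V -> bool).
    by apply/funext => x /=; apply/asboolP/idP.
  by rewrite X0; split => // /(_ 0); apply; case: cN.
- exists (fun x => `[< X x >]); split => //.
  + by move=> x Nx; apply/asboolP; exact: NX.
  + by apply/asboolP.
  move=> Q cQ XQ vQ x Qx; apply/asboolP; apply: contrapT => Xx.
  apply: (maxX [set x | x \in Q]%classic).
    by split=> [y Xy|/(_ x Qx)//]; apply: XQ; apply/asboolP.
  right; split => /=; last by move=> Qv; rewrite Qv in vQ.
    have -> // : (fun x => `[< [set x | x \in Q]%classic x >]) = Q :> (V -> bool).
    by apply/funext => y /=; apply/asboolP/idP.
  by move=> y Ny; apply: XQ; apply/asboolP; exact: NX.
Qed.

Section Radical.
Variable A : pzRingType.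
Implicit Types (x y : A).

Definition left_invertible x := exists y, y * x = 1.

Lemma max_left_ideal_mul (M : {pred A}) a x :
  max_left_ideal M -> x \in M -> a * x \in M.
Proof.
by move=> [[M0 cM] _ _] Mx; have := cM a x 0 Mx M0; rewrite addr0.
Qed.

Lemma max_left_ideal_subr (M : {pred A}) x :
  max_left_ideal M -> x \in M -> 1 - x \notin M.
Proof.
move=> [[M0 cM] M1 _] Mx; apply: contraNN M1 => M1x.
by have := cM 1 _ _ M1x Mx; rewrite scale1r subrK.
Qed.

Lemma not_left_invertible x :
  ~ left_invertible x -> exists2 M, max_left_ideal M & x \in M.
Proof.
move=> xN; have [||P [cP xP P1 maxP]] := @max_submod A A^o (lprinc x) 1.
- exact: lprinc_closed.
- by apply/asboolP => -[r r1]; apply: xN; exists r.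
exists P; last by apply: xP; apply/asboolP; exists 1; rewrite mul1r.
by split.
Qed.

(** If a maximal left ideal M misses x, then 1 = m + a x for some m in M, and
    the left inverse of m = 1 - a x puts 1 into M. *)
Lemma jacobsonP x :
  x \in jacobson A <-> forall a, left_invertible (1 - a * x).
Proof.
split=> [Jx a|inv].
  apply: contrapT => /not_left_invertible[M maxM].
  by apply/negP/max_left_ideal_subr => //; have /asboolP := jacobsonMl a Jx; apply.
apply/asboolP => M maxM; apply: contrapT => /negP xM.
pose Q : {pred A} := fun z => `[< exists2 m, m \in M & exists a, z = m + a * x >].
case: (maxM) => -[M0 cM] M1 maxM'.
have cQ : submod_closed (Q : {pred A^o}).
  split; first by apply/asboolP; exists 0 => //; exists 0; rewrite mul0r addr0.
  move=> r _ _ /asboolP[m1 hm1 [r1 ->]] /asboolP[m2 hm2 [r2 ->]].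
  apply/asboolP; exists (r *: (m1 : A^o) + m2); first exact: cM.
  exists (r * r1 + r2); rewrite -![_ *: _]/(_ * _).
  by rewrite mulrDr mulrDl !mulrA addrACA.
have MQ : {subset M <= Q}.
  by move=> m hm; apply/asboolP; exists m => //; exists 0; rewrite mul0r addr0.
have xQ : x \in Q by apply/asboolP; exists 0 => //; exists 1; rewrite mul1r add0r.
have [/asboolP[m Mm [a e1]]|Q1] := boolP (1 \in Q); last first.
  by rewrite (maxM' Q cQ MQ Q1 _ xQ) in xM.
have [b b1] := inv a; case/negP: M1; rewrite -b1 e1 addrK.
exact: max_left_ideal_mul.
Qed.

(** A left inverse y of 1 - x is of the form 1 + y x, so that it has itself a
    left inverse, which can only be 1 - x. *)
Lemma jacobson_unit x :
  x \in jacobson A -> exists2 y, y * (1 - x) = 1 & (1 - x) * y = 1.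
Proof.
move=> Jx; have [y] : left_invertible (1 - x).
  by have /jacobsonP/(_ 1) := Jx; rewrite mul1r.
move=> y1; exists y => //.
have ey : y = 1 - (- y) * x.
  by rewrite -[in RHS]y1 mulNr opprK mulrBr mulr1 subrK.
have [z] : left_invertible y by rewrite ey; move/jacobsonP: Jx; apply.
by move=> zy; have <- : z = 1 - x by rewrite -[LHS]mulr1 -[X in _ * X]y1 mulrA zy mul1r.
Qed.

(** A criterion that mentions only the operations of the ring: it passes at
    once between two ring structures that have the same operations but
    different proofs of the axioms. *)
Lemma local_ringP : local_ring A <->
  (1 != 0 :> A) /\ forall x, left_invertible x \/ left_invertible (1 - x).
Proof.
split=> [[M maxM uniqM]|[one_neq0 loc]].
  split=> [|x].
    by case: maxM => -[M0 _] M1 _; apply: contraNneq M1 => ->.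
  apply: contrapT => /not_orP[/not_left_invertible[M1 m1 M1x]].
  move=> /not_left_invertible[M2 m2 M2x].
  rewrite uniqM // in M1x; rewrite uniqM // in M2x.
  by case/negP: (max_left_ideal_subr maxM M1x).
pose M : {pred A} := fun x => `[< ~ left_invertible x >].
have maxM : max_left_ideal M.
  split.
  - split; first by apply/asboolP => -[y]; rewrite mulr0 => /esym/eqP; apply/negP.
    move=> a x y /asboolP xN /asboolP yN; apply/asboolP => -[z].
    rewrite mulrDr -[_ *: _]/(_ * _) => e1.
    have [[w]|] := loc (z * (a * x)).
      by rewrite !mulrA => ?; apply: xN; exists (w * z * a).
    rewrite -e1 [X in X - _]addrC addrK => -[w wzy].
    by apply: yN; exists (w * z); rewrite -mulrA.
  - by apply/asboolP => /(_ (ex_intro _ 1 (mulr1 1))).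
  - move=> L [L0 cL] _ L1 x Lx; apply/asboolP => -[y yx].
    by have := cL y x 0 Lx L0; rewrite addr0 -[_ *: _]/(_ * _) yx (negPf L1).
exists M => // M' maxM'.
have sub : {subset M' <= M}.
  move=> x Mx; apply/asboolP => -[y yx]; case: (maxM') => _ /negP[].
  by rewrite -yx; exact: max_left_ideal_mul.
move=> x; apply/idP/idP => [|Mx]; first exact: sub.
by case: maxM' => _ _ /(_ M); apply => //; case: maxM.
Qed.

Hypothesis localA : local_ring A.

Lemma jacobson_local x : x \in jacobson A <-> ~ left_invertible x.
Proof.
have /local_ringP[one_neq0 loc] := localA.
split=> [/jacobsonP inv [y yx]|xN].
  by have [z /esym/eqP] := inv y; rewrite yx subrr mulr0 (negPf one_neq0).
apply/jacobsonP => a; have [[y]|//] := loc (a * x).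
by rewrite mulrA => yx; case: xN; exists (y * a).
Qed.

Lemma local_idempotent x : x * x = x -> x = 0 \/ x = 1.
Proof.
move=> xx; have /local_ringP[_ /(_ x)[[y yx]|[y yx]]] := localA.
  by right; rewrite -[x]mul1r -yx -mulrA xx.
by left; rewrite -[x]mul1r -yx -mulrA mulrBl mul1r xx subrr mulr0.
Qed.

End Radical.

(** * Socles and tops of the modules generated by orthogonal idempotents *)

Lemma lprincP (A : pzRingType) (e x : A) :
  e * e = e -> (x \in lprinc e) <-> x * e = x.
Proof.
move=> ee; split=> [/asboolP[r ->]|xe]; first by rewrite -mulrA ee.
by apply/asboolP; exists x.
Qed.

Lemma lprinc_self (A : pzRingType) (e : A) : e \in lprinc e.
Proof. by apply/asboolP; exists 1; rewrite mul1r. Qed.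

(** The ring A and its ideal J are kept apart, so that the results also apply
    to the converse of a ring R with the Jacobson radical of R. *)
Section SocleTop.
Variables (A : pzRingType) (J : {pred A}) (I : finType) (e : I -> A).
Hypothesis e_idem : forall i, e i * e i = e i.
Hypothesis e_sum : \sum_i e i = 1.
Hypothesis e_neq0 : forall i, e i != 0.
Hypothesis idealJ : two_sided_ideal J.
Hypothesis J_unit : forall x, x \in J -> left_invertible (1 - x).
Hypothesis J_off : forall i j x, i != j -> e i * x * e j \in J.
Hypothesis J_local : forall i x, e i * x * e i \notin J ->
  exists y, y * (e i * x * e i) = e i.

Definition killed (x : A) := forall j, j \in J -> j * x = 0.

Lemma idem_decomp (x : A) : x = \sum_i e i * x.
Proof. by rewrite -mulr_suml e_sum mul1r. Qed.

Lemma idem_notin i : e i \notin J.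
Proof.
apply/negP => /J_unit[y y1]; have := e_neq0 i; rewrite -[e i]mul1r -y1 -mulrA.
by rewrite mulrBl mul1r e_idem subrr mulr0 eqxx.
Qed.

(** Some e k r x is not 0. Since J kills x, the element e k r (e i) is outside
    J; hence k = i, and it is invertible in the local corner. *)
Lemma killed_generates i r x :
  e i * x = x -> killed x -> r * x != 0 -> exists s, s * (r * x) = x.
Proof.
move=> ex kx rx0.
have [k ek0] : exists k, e k * (r * x) != 0.
  apply: contrapT => no; case/eqP: rx0; rewrite [LHS]idem_decomp big1 // => k _.
  by apply: contrapT => /eqP ek; apply: no; exists k.
have erx : e k * (r * x) = e k * r * e i * x by rewrite -{1}ex !mulrA.
have nJ : e k * r * e i \notin J.
  by apply: contraNN ek0 => /kx; rewrite erx => ->.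
have ki : k = i by apply: contraNeq nJ => ki; exact: J_off.
subst k; have [y ye] := J_local nJ; exists (y * e i).
by rewrite -mulrA erx mulrA ye.
Qed.

Lemma killed_simple i x :
  e i * x = x -> killed x -> x != 0 -> simple_submod (lprinc x).
Proof.
move=> ex kx x0; split; first exact: lprinc_closed.
  by exists x => //; exact: lprinc_self.
move=> P [P0 cP] Px.
have [[y Py y0]|no] := pselect (exists2 y, y \in P & y != 0); last first.
  by left=> y Py; apply: contrapT => /eqP y0; apply: no; exists y.
right=> z /asboolP[r ->]; have /asboolP[s ys] := Px y Py.
rewrite ys in y0; have [u ux] := killed_generates ex kx y0.
have := cP (r * u) y 0 Py P0; rewrite addr0 -[_ *: _]/(_ * _).
by rewrite ys -mulrA ux.
Qed.

(** Otherwise N is generated by j x, and x = r j x with r j in J forces x = 0,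
    as in Nakayama's lemma. *)
Lemma simple_killed (N : {pred A^o}) x : simple_submod N -> x \in N -> killed x.
Proof.
move=> [[N0 cN] _ minN] Nx j Jj; apply: contrapT => /eqP jx0.
case: (minN (lprinc (j * x))) => [|y /asboolP[r ->]||/(_ x Nx)/asboolP[r xr]].
- exact: lprinc_closed.
- by have := cN (r * j) x 0 Nx N0; rewrite addr0 -[_ *: _]/(_ * _) mulrA.
- by move=> /(_ _ (lprinc_self _)) /eqP; rewrite (negPf jx0).
have [|y y1] := @J_unit (r * j).
  by case: idealJ => _ Jl _; exact: Jl.
case/eqP: jx0; suff -> : x = 0 by rewrite mulr0.
by rewrite -[x]mul1r -y1 -mulrA mulrBl mul1r -mulrA -xr subrr mulr0.
Qed.

(** The socle is the annihilator of J: the components e i x of an element x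
    killed by J are 0 or generate simple modules. *)
Lemma socP f x : x \in soc (lprinc f) <-> x \in lprinc f /\ killed x.
Proof.
split=> [/asboolP sx|[fx kx]].
  apply/asboolP; apply: (sx (fun x => `[< x \in lprinc f /\ killed x >])); last first.
    move=> y [N [sN Nf Ny]]; apply/asboolP.
    by split; [exact: Nf | exact: simple_killed Ny].
  split; first by apply/asboolP; split; [exact: rpred0 | move=> j _; rewrite mulr0].
  move=> a y z /asboolP[fy ky] /asboolP[fz kz]; apply/asboolP; split.
    by apply: rpredD => //; exact: rpredZ.
  move=> j Jj; rewrite mulrDr kz // addr0 -[_ *: _]/(_ * _) mulrA ky //.
  by case: idealJ => _ _; apply.
rewrite [x]idem_decomp; apply: rpred_sum => i _.
have [->|ex0] := eqVneq (e i * x) 0; first exact: rpred0.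
have fex : e i * x \in lprinc f by exact: (@rpredZ _ _ _ (e i) (x : A^o)).
apply/asboolP => P cP; apply; exists (lprinc (e i * x)); split.
- apply: (@killed_simple i) => //; first by rewrite mulrA e_idem.
  by move=> j Jj; rewrite mulrA kx //; case: idealJ => _ _; apply.
- move=> _ /asboolP[r ->].
  exact: (@rpredZ _ _ _ r (e i * x : A^o)).
- exact: lprinc_self.
Qed.

(** The map y |-> y t on A (e p) has kernel J :&: A (e p), so it induces an
    embedding of the top of A (e p). *)
Lemma killed_annihilator p t y :
  e p * t = t -> t != 0 -> killed t -> y * e p = y -> (y * t = 0) <-> (y \in J).
Proof.
move=> et t0 kt ye; split=> [yt|/kt//].
rewrite [y]idem_decomp; case: (idealJ) => zJ _ _.
have addJ : {in J &, forall a b, a + b \in J}.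
  have [J0 subJ] := zJ.
  by move=> a b Ja Jb; rewrite -[b]opprK -[- b]sub0r; apply: (subJ) => //; apply: subJ.
apply: (big_ind (fun z => z \in J)) => //; first by case: zJ.
move=> k _; rewrite -ye mulrA.
have [->|] := eqVneq k p; last exact: J_off.
apply: contraT => /J_local[z ze]; case/eqP: t0.
by rewrite -et -ze -!mulrA et yt !mulr0.
Qed.

Lemma ideal_actP p (v : modL (e p)) :
  v \in ideal_act J (predT : {pred modL (e p)}) <-> val v \in J.
Proof.
case: (idealJ) => -[J0 subJ] Jl Jr.
split=> [/asboolP/(_ (fun v => val v \in J))|Jv]; last first.
  pose ep : modL (e p) := Sub (e p) (lprinc_self (e p)).
  have -> : v = (val v : A) *: ep.
    apply: val_inj; rewrite /= -[RHS]/(val v * e p).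
    by rewrite ((lprincP _ (e_idem p)).1 (valP v)).
  by apply/asboolP => P cP; apply; exists (val v), ep.
apply; last by move=> _ [j [w [Jj _ ->]]]; rewrite unfold_in /=; exact: Jr.
split=> [|a x y]; first by rewrite unfold_in.
rewrite !unfold_in /= => Jx Jy.
rewrite -[val y]opprK -[- val y]sub0r; apply: (subJ); first exact: Jl.
exact: subJ.
Qed.

(** Such a t is the image of the class of e p under an isomorphism from the top
    of A (e p) onto the socle of A (e i). *)
Definition socle_generator i p t :=
  [/\ e p * t = t, t * e i = t, t != 0, killed t &
      forall x, x * e i = x -> killed x -> exists r, x = r * t].

Lemma soc_top_generator i p :
  lmod_iso (submod_type (soc (lprinc (e i))))
    (quot_mod (ideal_act J (predT : {pred modL (e p)}))) ->
  exists t, socle_generator i p t.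
Proof.
move=> [f [g fK gK]].
pose ep : modL (e p) := Sub (e p) (lprinc_self (e p)).
pose Y := ideal_act J (predT : {pred modL (e p)}).
pose te : quot_mod Y := quot_proj Y ep.
have gE : forall a u, g (a *: u) = a *: g u.
  by move=> a u; apply: (can_inj fK); rewrite linearZ /= !gK.
have Ete a : a *: te = quot_proj Y (a *: ep) by rewrite /te quot_projZ.
have gte : val (g te) \in soc (lprinc (e i)) := valP (g te).
have [fg kg] := (socP _ _).1 gte.
exists (val (g te)); split => //.
- rewrite -[e p * _]/(val (e p *: g te)) -gE; congr (val (g _)).
  rewrite Ete; congr (quot_proj _ _); apply: val_inj.
  by rewrite /= -[_ *: _]/(_ * _) e_idem.
- exact/lprincP.
- apply/eqP => g0; have /negP[] := idem_notin p.
  have {g0} : g te = 0 by apply: val_inj.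
  move/(congr1 f); rewrite gK linear0 => te0.
  have := (quot_projE Y ep 0).1; rewrite subr0 => /(_ _)/ideal_actP; apply.
  by rewrite -[LHS]/te te0 -(scale0r ep) -Ete scale0r.
move=> x xe kx.
have sx : x \in soc (lprinc (e i)) by apply/socP; split => //; apply/lprincP.
pose u : submod_type (soc (lprinc (e i))) := Sub x sx.
have [y yE] : exists y, f u = quot_proj Y y.
  by exists (repr (f u)); rewrite quot_projK.
have yE' : f u = (val y : A) *: te.
  rewrite yE Ete; congr (quot_proj _ _); apply: val_inj => /=.
  by symmetry; apply/lprincP => //; exact: valP y.
exists (val y); rewrite -[x]/(val u) -(fK u) yE' gE.
by [].
Qed.

Lemma generator_soc_top i p t : socle_generator i p t ->
  lmod_iso (submod_type (soc (lprinc (e i))))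
    (quot_mod (ideal_act J (predT : {pred modL (e p)}))).
Proof.
move=> [et te t0 kt gen].
pose Y := ideal_act J (predT : {pred modL (e p)}).
pose S := submod_type (soc (lprinc (e i))).
have coef (u : S) : {r | val u = r * e p * t}.
  apply: cid; have [fu ku] := (socP _ _).1 (valP u).
  by have [||r ur] := gen (val u); [apply/lprincP | | exists r; rewrite -mulrA et].
have mem r : r * e p \in lprinc (e p) by apply/asboolP; exists r.
pose h r : modL (e p) := Sub (r * e p) (mem r).
pose f (u : S) : quot_mod Y := quot_proj Y (h (projT1 (coef u))).
have hE (v w : modL (e p)) : (quot_proj Y v = quot_proj Y w) <-> val v * t = val w * t.
  rewrite quot_projE; split=> [/ideal_actP|eqt].
    have ann := killed_annihilator et t0 kt ((lprincP _ (e_idem p)).1 (valP (v - w))).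
    by move/ann/eqP; rewrite /= mulrBl subr_eq0 => /eqP.
  apply/ideal_actP; apply/(killed_annihilator et t0 kt).
    exact: (lprincP _ (e_idem p)).1 (valP (v - w)).
  by rewrite /= mulrBl eqt subrr.
have fE (u : S) (v : modL (e p)) : val v * t = val u -> f u = quot_proj Y v.
  by move=> vu; apply/hE; rewrite /h /= vu; case: (coef u).
have ft (u : S) : exists2 v : modL (e p), val v * t = val u & f u = quot_proj Y v.
  by exists (h (projT1 (coef u))) => //; rewrite /h /=; case: (coef u).
have lf : linear f.
  move=> a u w; have [v vu ->] := ft u; have [v' vw ->] := ft w.
  rewrite -[a *: quot_proj _ _]/(quot_scale a _) -quot_projZ -quot_projD; apply: fE.
  rewrite -[LHS]/((a * val v + val v') * t) -[RHS]/(a * val u + val w).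
  by rewrite mulrDl -mulrA vu vw.
have kv (v : modL (e p)) : val v * t \in soc (lprinc (e i)).
  apply/socP; split; first by apply/lprincP; rewrite // -mulrA te.
  by move=> j Jj; rewrite mulrA kt //; case: idealJ => _ _; apply.
pose fl := GRing.isLinear.Build A S (quot_mod Y) _ f lf.
pose f' : {linear S -> quot_mod Y} := HB.pack f fl.
exists f'; exists (fun w => Sub (val (repr w : modL (e p)) * t) (kv _)).
  move=> u; apply: val_inj => /=; have [v <- fuE] := ft u.
  by rewrite [f u]fuE; apply/hE; rewrite quot_projK.
by move=> w; rewrite /= -[RHS]quot_projK; exact: fE.
Qed.

End SocleTop.

(** The homomorphisms from A e to A f are the right multiplications by the
    elements of e A f. *)
Lemma lprinc_iso (A : pzRingType) (e f : A) : e * e = e -> f * f = f ->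
  lmod_iso (modL e) (modL f) <->
  exists a b, [/\ a * b = e, b * a = f, e * a * f = a & f * b * e = b].
Proof.
move=> ee ff; split=> [[h [g hK gK]]|[a [b [ab ba ea fb]]]].
  pose e' : modL e := Sub e (lprinc_self e).
  pose f' : modL f := Sub f (lprinc_self f).
  have gE u v : g (u *: v) = u *: g v.
    by apply: (can_inj hK); rewrite linearZ /= !gK.
  have he (v : modL e) : v = (val v : A) *: e'.
    by apply: val_inj; rewrite /= -[RHS]/(_ * _) ((lprincP _ ee).1 (valP v)).
  have hf (v : modL f) : v = (val v : A) *: f'.
    by apply: val_inj; rewrite /= -[RHS]/(_ * _) ((lprincP _ ff).1 (valP v)).
  have ea : val (h e') * f = val (h e') := (lprincP _ ff).1 (valP (h e')).
  have fb : val (g f') * e = val (g f') := (lprincP _ ee).1 (valP (g f')).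
  have eh : e * val (h e') = val (h e').
    by rewrite -[LHS]/(val (e *: h e')) -linearZ -(he e').
  have fg : f * val (g f') = val (g f').
    by rewrite -[LHS]/(val (f *: g f')) -gE -(hf f').
  exists (val (h e')), (val (g f')); split; rewrite ?eh ?fg //.
    by rewrite -[LHS]/(val ((val (h e') : A) *: (g f' : modL e))) -gE -hf hK.
  by rewrite -[LHS]/(val ((val (g f') : A) *: (h e' : modL f))) -linearZ -he gK.
have ma (v : modL e) : val v * a \in lprinc f.
  by apply/lprincP; rewrite // -ea -!mulrA ff.
have mb (v : modL f) : val v * b \in lprinc e.
  by apply/lprincP; rewrite // -fb -!mulrA ee.
pose h (v : modL e) : modL f := Sub (val v * a) (ma v).
have lh : linear h.
  move=> c u v; apply: val_inj.
  rewrite -[LHS]/((c * val u + val v) * a) -[RHS]/(c * (val u * a) + val v * a).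
  by rewrite mulrDl mulrA.
pose hl := GRing.isLinear.Build A (modL e) (modL f) _ h lh.
pose h' : {linear modL e -> modL f} := HB.pack h hl.
exists h'; exists (fun v => Sub (val v * b) (mb v)) => v; apply: val_inj => /=.
  by rewrite -mulrA ab ((lprincP _ ee).1 (valP v)).
by rewrite -mulrA ba ((lprincP _ ff).1 (valP v)).
Qed.

(** * Radical, socles and tops of a formal matrix ring, entry by entry *)

Section FormalMatrices.
Variables (n : nat) (F : formal_data n).
Implicit Types (i j k l : 'I_n) (x y : fm_matrix F).

(** The radical of the category with objects the indices and morphisms the
    entries: as the corners are local, a is outside it as soon as a has a left
    inverse. *)
Definition fm_rad i j (a : F i j) := forall b : F j i, fm_mul b a <> fm_one F j.

(** Distinct indices are not isomorphic in the category of entries; this is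
    equivalent to [basic] by [basicP]. *)
Definition strictly_basic := forall i j (a : F i j), i != j -> fm_rad a.

Definition right_socle i j (x : F i j) :=
  forall k (a : F j k), fm_rad a -> fm_mul x a = 0.

Definition left_socle i j (x : F i j) :=
  forall k (a : F k i), fm_rad a -> fm_mul a x = 0.

(** The form that soc(e_i R) = top(e_p R), up to isomorphism, takes on entries,
    see [right_soc_top]. *)
Definition right_paired i p := exists t : F i p,
  [/\ t != 0, right_socle t &
      forall j (x : F i j), right_socle x -> exists r : F p j, x = fm_mul t r].

Definition left_paired p i := exists t : F i p,
  [/\ t != 0, left_socle t &
      forall j (x : F j p), left_socle x -> exists r : F j i, x = fm_mul r t].

Lemma fm_mulNl i j k (a : F i j) (b : F j k) : fm_mul (- a) b = - fm_mul a b.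
Proof. by apply/eqP; rewrite -addr_eq0 -fm_mulDl addNr fm_mul0l. Qed.

Lemma fm_mulNr i j k (a : F i j) (b : F j k) : fm_mul a (- b) = - fm_mul a b.
Proof. by apply/eqP; rewrite -addr_eq0 -fm_mulDr addNr fm_mul0r. Qed.

Lemma fmx_atM x y i k :
  fmx_at (x * y) i k = \sum_j fm_mul (fmx_at x i j) (fmx_at y j k).
Proof. exact: fmxE. Qed.

Lemma fmx_at0 i j : fmx_at (0 : fm_matrix F) i j = 0.
Proof. exact: fmxE. Qed.

Lemma fmx_atN x i j : fmx_at (- x) i j = - fmx_at x i j.
Proof. exact: fmxE. Qed.

Lemma fmx_at_sum (I : finType) (f : I -> fm_matrix F) i j :
  fmx_at (\sum_s f s) i j = \sum_s fmx_at (f s) i j.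
Proof.
apply: (big_morph (fun x => fmx_at x i j)); last exact: fmx_at0.
by move=> x y; exact: fmx_addE.
Qed.

(** The entries of an identity matrix, used as factors, put a at position
    (i, j) without any transport of a along equalities of indices. *)
Definition single i j (a : F i j) : fm_matrix F :=
  fmx (fun k l => fm_mul (fm_mul (fm_id F k i) a) (fm_id F j l)).

Lemma mul_idE i k (f : forall l, F i l) :
  \sum_l fm_mul (f l) (fm_id F l k) = f k.
Proof.
rewrite (bigD1 k) //= fm_id_diag fm_mul1r big1 ?addr0 // => l lk.
by rewrite fm_id_off // fm_mul0r.
Qed.

Lemma id_mulE i k (f : forall l, F l k) :
  \sum_l fm_mul (fm_id F i l) (f l) = f i.
Proof.
rewrite (bigD1 i) //= fm_id_diag fm_mul1l big1 ?addr0 // => l li.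
by rewrite fm_id_off ?fm_mul0l // eq_sym.
Qed.

Lemma singleE i j (a : F i j) : fmx_at (single a) i j = a.
Proof. by rewrite fmxE !fm_id_diag fm_mul1l fm_mul1r. Qed.

Lemma single_off_row i j (a : F i j) k l : k != i -> fmx_at (single a) k l = 0.
Proof. by move=> ki; rewrite fmxE fm_id_off // !fm_mul0l. Qed.

Lemma single_off_col i j (a : F i j) k l : l != j -> fmx_at (single a) k l = 0.
Proof. by move=> lj; rewrite fmxE (@fm_id_off _ _ j) 1?eq_sym // fm_mul0r. Qed.

Lemma fmx_at_mul_single x i j (a : F i j) k l :
  fmx_at (x * single a) k l = fm_mul (fm_mul (fmx_at x k i) a) (fm_id F j l).
Proof.
rewrite fmx_atM (bigD1 i) //= big1 ?addr0 => [|m mi].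
  by rewrite fmxE fm_id_diag fm_mul1l fm_mulA.
by rewrite single_off_row // fm_mul0r.
Qed.

Lemma fmx_at_single_mul x i j (a : F i j) k l :
  fmx_at (single a * x) k l = fm_mul (fm_id F k i) (fm_mul a (fmx_at x j l)).
Proof.
rewrite fmx_atM (bigD1 j) //= big1 ?addr0 => [|m mi].
  by rewrite fmxE fm_id_diag fm_mul1r fm_mulA.
by rewrite single_off_col // fm_mul0l.
Qed.

Lemma singleM i j k (a : F i j) (b : F j k) :
  single a * single b = single (fm_mul a b).
Proof.
apply: fm_matrixP => l m.
by rewrite fmx_at_mul_single !fmxE fm_id_diag fm_mul1r !fm_mulA.
Qed.

Lemma singleD i j (a b : F i j) : single (a + b) = single a + single b.
Proof.
by apply: fm_matrixP => l m; rewrite fmx_addE !fmxE fm_mulDr fm_mulDl.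
Qed.

Lemma singleN i j (a : F i j) : single (- a) = - single a.
Proof.
by apply: fm_matrixP => l m; rewrite fmx_atN !fmxE fm_mulNr fm_mulNl.
Qed.

Lemma single0 i j : single (0 : F i j) = 0.
Proof.
by apply: fm_matrixP => l m; rewrite fmx_at0 !fmxE fm_mul0r fm_mul0l.
Qed.

Lemma fmx_idemE i : fmx_idem F i = single (fm_one F i).
Proof.
apply: fm_matrixP => k l; rewrite !fmxE fm_mul1r.
case: (eqVneq k i) => [->|ki] /=; last by rewrite fm_id_off // fm_mul0l.
by rewrite fm_id_diag fm_mul1l; case: (eqVneq l i) => //= li; rewrite fm_id_off // eq_sym.
Qed.

Lemma idem_mulE x i k l :
  fmx_at (fmx_idem F i * x) k l = if k == i then fmx_at x k l else 0.
Proof.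
rewrite fmx_idemE fmx_at_single_mul fm_mul1l.
by case: (eqVneq k i) => [->|ki]; rewrite ?fm_id_diag ?fm_mul1l // fm_id_off // fm_mul0l.
Qed.

Lemma mul_idemE x i k l :
  fmx_at (x * fmx_idem F i) k l = if l == i then fmx_at x k l else 0.
Proof.
rewrite fmx_idemE fmx_at_mul_single fm_mul1r.
case: (eqVneq l i) => [->|li]; first by rewrite fm_id_diag fm_mul1r.
by rewrite fm_id_off ?fm_mul0r // eq_sym.
Qed.

Lemma idem_mul_idem x i j :
  fmx_idem F i * x * fmx_idem F j = single (fmx_at x i j).
Proof.
apply: fm_matrixP => k l; rewrite mul_idemE idem_mulE.
case: (eqVneq l j) => [->|lj]; last by rewrite single_off_col.
by case: (eqVneq k i) => [->|ki]; rewrite ?singleE // single_off_row.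
Qed.

Lemma fmx_idem_idem i : fmx_idem F i * fmx_idem F i = fmx_idem F i.
Proof. by rewrite fmx_idemE singleM fm_mul1l. Qed.

Lemma fmx_idem_sum : \sum_i fmx_idem F i = 1.
Proof.
apply: fm_matrixP => k l; rewrite fmx_at_sum fmxE.
rewrite (bigD1 k) //= big1 ?addr0 => [|i ik].
  rewrite fmxE eqxx /=; case: eqVneq => // lk.
  by rewrite fm_id_off // eq_sym.
by rewrite fmxE [k == i]eq_sym (negPf ik).
Qed.

Lemma single_support i j (a : F i j) :
  fmx_idem F i * single a = single a /\ single a * fmx_idem F j = single a.
Proof. by rewrite !fmx_idemE !singleM fm_mul1l fm_mul1r. Qed.

Lemma rad_mull i j k (a : F i j) (b : F j k) : fm_rad b -> fm_rad (fm_mul a b).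
Proof. by move=> rb c; rewrite -fm_mulA; exact: rb. Qed.

Hypothesis localF : forall i, local_ring (fm_corner F i).

Lemma fm_one_neq0 i : fm_one F i != 0.
Proof. by have /local_ringP[] := localF i. Qed.

(** The product a b is an idempotent of a local corner, and it is not 0. *)
Lemma fm_left_inverse i j (a : F i j) (b : F j i) :
  fm_mul b a = fm_one F j -> fm_mul a b = fm_one F i.
Proof.
move=> ba; case: (@local_idempotent _ (localF i) (fm_mul a b)) => //.
  by rewrite -[_ * _]/(fm_mul _ _) fm_mulA -(fm_mulA b) ba fm_mul1l.
move=> ab0; case/eqP: (fm_one_neq0 j).
by rewrite -[LHS]fm_mul1l -ba fm_mulA -(fm_mulA a) ab0 fm_mul0l fm_mul0r.
Qed.

Lemma rad_mulr i j k (a : F i j) (b : F j k) : fm_rad a -> fm_rad (fm_mul a b).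
Proof.
move=> ra c; rewrite -fm_mulA => cab; apply: (ra (fm_mul b c)).
by rewrite fm_mulA; exact: fm_left_inverse.
Qed.

Lemma rad0 i j : fm_rad (0 : F i j).
Proof. by move=> b; rewrite fm_mul0r => /esym/eqP; apply/negP/fm_one_neq0. Qed.

Lemma rad_local i (a : F i i) : fm_rad a <-> a \in jacobson (fm_corner F i).
Proof.
rewrite jacobson_local //; split=> [ra [b]|ra b ba]; first exact: ra.
by apply: ra; exists b.
Qed.

Lemma rad_or_invertible i j (a : F i j) : fm_rad a \/ exists b, fm_mul b a = fm_one F j.
Proof.
have [|no] := pselect (exists b, fm_mul b a = fm_one F j); [by right | left].
by move=> b ba; apply: no; exists b.
Qed.

(** For c = x (single a), a matrix supported by column j, only 1 - c_jj has to
    be inverted: if u is its inverse, 1 + c u is a left inverse of 1 - c. *)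
Lemma jacobson_single i j (a : F i j) : fm_rad a -> single a \in jacobson (fm_matrix F).
Proof.
move=> ra; apply/jacobsonP => x; set c := x * single a.
have cj : c * fmx_idem F j = c by rewrite -mulrA (single_support a).2.
have /rad_local/jacobsonP/(_ 1) : fm_rad (fmx_at c j j).
  rewrite fmx_at_mul_single fm_id_diag fm_mul1r; exact: rad_mull.
rewrite mul1r => -[u]; rewrite -[u * _]/(fm_mul _ _) => u1.
exists (1 + c * single (u : F j j)).
have uc : single (u : F j j) * (1 - c) = fmx_idem F j.
  clearbody c; rewrite -(single_support (u : F j j)).2 -mulrA -cj.
  have -> : fmx_idem F j * (1 - c * fmx_idem F j) = single (fm_one F j - fmx_at c j j).
    by rewrite mulrBr mulr1 mulrA idem_mul_idem fmx_idemE singleD singleN.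
  by rewrite singleM u1 fmx_idemE.
by rewrite mulrDl mul1r -mulrA uc cj subrK.
Qed.

(** A matrix is the sum of its single entries, which gives one inclusion. For
    the other one, if b x_ij = 1 for an entry of some x in the Jacobson
    radical, then this ideal contains the nonzero idempotent e_j. *)
Lemma jacobson_fmxP x : x \in jacobson (fm_matrix F) <-> forall i j, fm_rad (fmx_at x i j).
Proof.
split=> [Jx i j b ba|rx].
  have /jacobson_unit[y y1 _] : fmx_idem F j \in jacobson (fm_matrix F).
    rewrite fmx_idemE -ba -(singleM b) -idem_mul_idem.
    by apply: jacobsonMl; apply: jacobsonMr; apply: jacobsonMl.
  suff e0 : fmx_idem F j = 0.
    case/eqP: (fm_one_neq0 j).
    by rewrite -[LHS]singleE -fmx_idemE e0 fmx_at0.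
  by rewrite -[LHS]mul1r -y1 -mulrA mulrBl mul1r fmx_idem_idem subrr mulr0.
have -> : x = \sum_i \sum_j single (fmx_at x i j).
  rewrite -[LHS]mul1r -fmx_idem_sum mulr_suml; apply: eq_bigr => i _.
  rewrite -[LHS]mulr1 -fmx_idem_sum mulr_sumr; apply: eq_bigr => j _.
  exact: idem_mul_idem.
by apply: rpred_sum => i _; apply: rpred_sum => j _; exact: jacobson_single.
Qed.

Lemma jacobson_ideal (A : pzRingType) : two_sided_ideal (jacobson A).
Proof.
by split; [exact: jacobson_zmod_closed | exact: jacobsonMl | exact: jacobsonMr].
Qed.

Lemma jacobson_ideal_conv (A : pzRingType) :
  two_sided_ideal (jacobson A : {pred A^c}).
Proof.
split; first exact: jacobson_zmod_closed.
- by move=> a x; exact: (@jacobsonMr A a x).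
- by move=> a x; exact: (@jacobsonMl A a x).
Qed.

Lemma fmx_idem_neq0 i : fmx_idem F i != 0.
Proof.
apply: contraNneq (fm_one_neq0 i) => e0.
by rewrite -[X in X == 0]singleE -fmx_idemE e0 fmx_at0.
Qed.

Hypothesis basicF : strictly_basic.

Lemma off_diag_jacobson i j x : i != j ->
  fmx_idem F i * x * fmx_idem F j \in jacobson (fm_matrix F).
Proof.
by move=> ij; rewrite idem_mul_idem; apply: jacobson_single; exact: basicF.
Qed.

Lemma corner_local i x : fmx_idem F i * x * fmx_idem F i \notin jacobson (fm_matrix F) ->
  exists2 y, y * (fmx_idem F i * x * fmx_idem F i) = fmx_idem F i &
             fmx_idem F i * x * fmx_idem F i * y = fmx_idem F i.
Proof.
rewrite idem_mul_idem; case: (rad_or_invertible (fmx_at x i i)) => [/jacobson_single ->//|].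
move=> [b ba] _; exists (single b); rewrite singleM fmx_idemE; first by rewrite ba.
by rewrite (fm_left_inverse ba).
Qed.

(** [soc_top_generator] and [generator_soc_top] for the ring of matrices; the
    generator t is a matrix with the single entry (p, i). *)
Lemma left_soc_top i p :
  lmod_iso (socL (fmx_idem F i)) (topL (fmx_idem F p)) <-> left_paired i p.
Proof.
have Junit x : x \in jacobson (fm_matrix F) -> left_invertible (1 - x).
  by case/jacobson_unit => y; exists y.
have loc k x : fmx_idem F k * x * fmx_idem F k \notin jacobson (fm_matrix F) ->
    exists y, y * (fmx_idem F k * x * fmx_idem F k) = fmx_idem F k.
  by case/corner_local => y; exists y.
split=> [iso|[t [t0 st gen]]].
  have [T [eT Te T0 kT gen]] := soc_top_generator fmx_idem_idem fmx_idem_sum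
     fmx_idem_neq0 (jacobson_ideal _) Junit off_diag_jacobson loc iso.
  have TE : T = single (fmx_at T p i) by rewrite -idem_mul_idem eT Te.
  exists (fmx_at T p i); split.
  - by apply: contra_neq T0 => t0; rewrite TE t0 single0.
  - move=> k a /jacobson_single/kT/(congr1 (fun z => fmx_at z k i)).
    by rewrite fmx_at_single_mul fmx_at0 fm_id_diag fm_mul1l.
  move=> j x sx; have [||r /(congr1 (fun z => fmx_at z j i))] := gen (single x).
  - by case: (single_support x).
  - move=> y /jacobson_fmxP Jy; apply: fm_matrixP => k l.
    by rewrite fmx_at_mul_single sx // fm_mul0l fmx_at0.
  rewrite singleE TE fmx_at_mul_single fm_id_diag fm_mul1r => ->.
  by exists (fmx_at r j p); rewrite singleE.
apply: (generator_soc_top fmx_idem_idem fmx_idem_sum (jacobson_ideal _) Junit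
  off_diag_jacobson loc (t := single t)).
split; try by case: (single_support t).
- by apply: contra_neq t0 => T0; rewrite -[t]singleE T0 fmx_at0.
- move=> y /jacobson_fmxP Jy; apply: fm_matrixP => k l.
  by rewrite fmx_at_mul_single st // fm_mul0l fmx_at0.
move=> x xe kx.
have ex j : exists r : F j p, fmx_at x j i = fm_mul r t.
  apply: gen => k a /jacobson_single/kx/(congr1 (fun z => fmx_at z k i)).
  by rewrite fmx_at_single_mul fmx_at0 fm_id_diag fm_mul1l.
pose r j := projT1 (cid (ex j)).
have rE j : fmx_at x j i = fm_mul (r j) t by rewrite /r; case: cid.
exists (fmx (fun k l => fm_mul (r k) (fm_id F p l))); apply: fm_matrixP => k l.
rewrite -{1}xe mul_idemE fmx_at_mul_single fmxE fm_id_diag fm_mul1r -rE.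
case: eqVneq => [->|li]; first by rewrite fm_id_diag fm_mul1r.
by rewrite fm_id_off ?fm_mul0r // eq_sym.
Qed.

(** The same in the converse ring. The Jacobson radical of R is used there as
    an ideal only, so it need not be compared with that of the converse. *)
Lemma right_soc_top i p :
  lmod_iso (socR (fmx_idem F i)) (topR (fmx_idem F p)) <-> right_paired i p.
Proof.
pose R := (fm_matrix F)^c.
pose e (k : 'I_n) : R := fmx_idem F k.
pose J : {pred R} := jacobson (fm_matrix F).
have e_idem (k : 'I_n) : e k * e k = e k := fmx_idem_idem k.
have e_sum : \sum_k e k = 1 := fmx_idem_sum.
have e0 (k : 'I_n) : e k != 0 := fmx_idem_neq0 k.
have Jid : two_sided_ideal J := jacobson_ideal_conv _.
have Junit (x : R) : x \in J -> left_invertible (1 - x).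
  by case/jacobson_unit => y _ y1; exists y.
have off k l (x : R) : k != l -> e k * x * e l \in J.
  rewrite -[_ * _]/((e l : fm_matrix F) * ((x : fm_matrix F) * (e k : fm_matrix F))).
  by rewrite mulrA eq_sym => kl; exact: off_diag_jacobson.
have loc k (x : R) : e k * x * e k \notin J -> exists y : R, y * (e k * x * e k) = e k.
  move=> nJ; have [|y _ y1] := @corner_local k (x : fm_matrix F).
    by rewrite -mulrA; exact: nJ.
  exists y; apply: etrans y1.
  exact: (congr1 (fun z : fm_matrix F => z * y) (mulrA (fmx_idem F k) x (fmx_idem F k))).
split=> [iso|[t [t0 st gen]]].
  have [T [eT Te T0 kT gen]] := soc_top_generator e_idem e_sum
     e0 Jid Junit off loc iso.
  have TE : T = single (fmx_at T i p).
    rewrite -idem_mul_idem -[X in X = _]eT -[X in _ * X = _]Te.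
    by rewrite -[LHS]/(fmx_idem F i * (T : fm_matrix F) * fmx_idem F p).
  exists (fmx_at T i p); split.
  - by apply: contra_neq T0 => t0; rewrite TE t0 single0.
  - move=> k a /jacobson_single/kT/(congr1 (fun z => fmx_at z i k)).
    rewrite -[(single a : R) * T]/((T : fm_matrix F) * single a).
    by rewrite fmx_at_mul_single fmx_at0 fm_id_diag fm_mul1r.
  move=> j x sx; have [||r] := gen (single x).
  - by case: (single_support x).
  - move=> y /jacobson_fmxP Jy; apply: fm_matrixP => k l.
    rewrite -[(y : R) * single x]/(single x * (y : fm_matrix F)).
    by rewrite fmx_at_single_mul sx // fm_mul0r fmx_at0.
  move/(congr1 (fun z => fmx_at z i j)).
  rewrite -[(r : R) * T]/((T : fm_matrix F) * (r : fm_matrix F)).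
  rewrite singleE TE fmx_at_single_mul fm_id_diag fm_mul1l => ->.
  by exists (fmx_at r p j); rewrite singleE.
apply: (generator_soc_top e_idem e_sum Jid Junit off loc (t := single t)).
split; try by case: (single_support t).
- by apply: contra_neq t0 => T0; rewrite -[t]singleE T0 fmx_at0.
- move=> y /jacobson_fmxP Jy; apply: fm_matrixP => k l.
  rewrite -[(y : R) * single t]/(single t * (y : fm_matrix F)).
  by rewrite fmx_at_single_mul st // fm_mul0r fmx_at0.
move=> x xe kx.
have ex j : exists r : F p j, fmx_at x i j = fm_mul t r.
  apply: gen => k a /jacobson_single/kx/(congr1 (fun z => fmx_at z i k)).
  rewrite -[(single a : R) * x]/((x : fm_matrix F) * single a).
  by rewrite fmx_at_mul_single fmx_at0 fm_id_diag fm_mul1r.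
pose r j := projT1 (cid (ex j)).
have rE j : fmx_at x i j = fm_mul t (r j) by rewrite /r; case: cid.
pose r' : fm_matrix F := fmx (fun k l => fm_mul (fm_id F k p) (r l)).
exists r'; apply: fm_matrixP => k l.
rewrite -[(r' : R) * single t]/(single t * r').
rewrite -[X in fmx_at X _ _ = _]xe -[(x : R) * e i]/(fmx_idem F i * (x : fm_matrix F)).
rewrite idem_mulE fmx_at_single_mul fmxE fm_id_diag fm_mul1l -rE.
case: eqVneq => [->|ki]; first by rewrite fm_id_diag fm_mul1l.
by rewrite fm_id_off ?fm_mul0l.
Qed.

End FormalMatrices.

(** An isomorphism of e_i R and e_j R is a pair of mutually inverse entries;
    between local corners, inverse on one side is enough. *)
Lemma basicP (n : nat) (F : formal_matrix_ring n) : basic F <-> strictly_basic F.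
Proof.
split=> [bF i j a ij b ba|sF i j ij].
  have ab := fm_left_inverse (@fm_local _ F) ba.
  apply: (bF i j ij); apply/lprinc_iso; do ?exact: fmx_idem_idem.
  exists (single b), (single a); split.
  - by rewrite -[LHS]/(single a * single b) singleM ab fmx_idemE.
  - by rewrite -[LHS]/(single b * single a) singleM ba fmx_idemE.
  - rewrite -[LHS]/(fmx_idem F j * (single b * fmx_idem F i)).
    by case: (single_support b) => eb ->.
  - rewrite -[LHS]/(fmx_idem F i * (single a * fmx_idem F j)).
    by case: (single_support a) => eb ->.
move/lprinc_iso => [||A [B [AB BA eA eB]]]; do ?exact: fmx_idem_idem.
have {}eA : A = single (fmx_at A j i).
  by rewrite -idem_mul_idem -mulrA -[LHS]eA.
have {}eB : B = single (fmx_at B i j).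
  by rewrite -idem_mul_idem -mulrA -[LHS]eB.
apply: (@sF j i (fmx_at A j i) _ (fmx_at B i j)); first by rewrite eq_sym.
move: AB; rewrite -[LHS]/((B : fm_matrix F) * (A : fm_matrix F)) eA eB.
rewrite singleM => /(congr1 (fun z => fmx_at z i i)).
by rewrite fmx_idemE !singleE.
Qed.

Lemma nakayamaP (n : nat) (F : formal_matrix_ring n) (p : 'S_n) :
  strictly_basic F -> nakayama_permutation F p <->
  forall i, right_paired F i (p i) /\ left_paired F (p i) i.
Proof.
have loc := @fm_local _ F.
move=> sF; split=> nak i; have [r l] := nak i; split.
- exact/(right_soc_top loc sF).
- exact/(left_soc_top loc sF).
- exact/(right_soc_top loc sF).
- exact/(left_soc_top loc sF).
Qed.

(** * A pair of bimodules with two nondegenerate pairings *)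

Section Separation.
Variables (D : pzRingType) (V : lmodType D).
Hypothesis D_inv : forall x : D, x != 0 -> left_invertible x.
Hypothesis D_neq0 : 1 != 0 :> D.

(** A submodule M maximal among those that miss v is a complement of the line
    through v, and f is the coordinate on this line. *)
Lemma separating_functional (v : V) : v != 0 -> exists f : V -> D,
  [/\ forall x y, f (x + y) = f x + f y, forall d x, f (d *: x) = d * f x &
      f v != 0].
Proof.
move=> v0; have [||M [[M0 cM] _ Mv maxM]] := @max_submod D V (pred1 0) v.
- split=> [|a x y]; rewrite !inE //= => /eqP-> /eqP->.
  by rewrite scaler0 addr0.
- by rewrite inE.
have MZ a x : x \in M -> a *: x \in M.
  by move=> Mx; rewrite -[_ *: _]addr0; apply: cM.
have MD x y : x \in M -> y \in M -> x + y \in M.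
  by move=> Mx My; rewrite -[x]scale1r; apply: cM.
have coef w : exists d, w - d *: v \in M.
  pose Q : {pred V} := fun z => `[< exists2 m, m \in M & exists a, z = m + a *: w >].
  have cQ : submod_closed Q.
    split; first by apply/asboolP; exists 0 => //; exists 0; rewrite scale0r addr0.
    move=> r _ _ /asboolP[m1 hm1 [r1 ->]] /asboolP[m2 hm2 [r2 ->]].
    apply/asboolP; exists (r *: m1 + m2); first exact: cM.
    by exists (r * r1 + r2); rewrite scalerDr scalerDl scalerA addrACA.
  have MQ : {subset M <= Q}.
    by move=> m Mm; apply/asboolP; exists m => //; exists 0; rewrite scale0r addr0.
  have wQ : w \in Q by apply/asboolP; exists 0 => //; exists 1; rewrite scale1r add0r.
  have [/asboolP[m Mm [d vE]]|Qv] := boolP (v \in Q); last first.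
    by exists 0; rewrite scale0r subr0; exact: (maxM Q).
  have [d0|/D_inv[y yd]] := eqVneq d 0.
    by rewrite vE d0 scale0r addr0 Mm in Mv.
  exists y; rewrite vE scalerDr scalerA yd scale1r opprD addrC subrK.
  by rewrite -scaleN1r; apply: (MZ); apply: (MZ).
have uniq w d d' : w - d *: v \in M -> w - d' *: v \in M -> d = d'.
  move=> Md Md'; apply/eqP; rewrite -subr_eq0.
  apply: contraNT Mv => /D_inv[y yd]; rewrite -[v]scale1r -yd -scalerA.
  apply: (MZ); have -> : (d - d') *: v = (w - d' *: v) - (w - d *: v).
    by rewrite opprB [RHS]addrC addrA subrK scalerBl.
  by apply: (MD) => //; rewrite -scaleN1r; exact: MZ.
exists (fun w => projT1 (cid (coef w))); split.
- move=> x y; case: (cid (coef x)) (cid (coef y)) (cid (coef _)) => a xa [b yb] [c xyc] /=.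
  apply: (uniq (x + y)) => //.
  by rewrite scalerDl opprD addrACA; exact: MD.
- move=> d x; case: (cid (coef x)) (cid (coef _)) => a xa [b xb] /=.
  by apply: (uniq (d *: x)) => //; rewrite -scalerA -scalerBr; exact: MZ.
case: (cid (coef v)) => a va /=; rewrite (uniq v a 1) //.
by rewrite scale1r subrr.
Qed.
End Separation.

Section DependentProduct.
Variables (I : Type) (W : I -> zmodType).

(** An alias of the type of dependent functions, to carry the pointwise
    additive structure. Dual spaces and direct sums are subgroups of it. *)
Definition dep_prod := forall i, W i.
HB.instance Definition _ := Choice.copy dep_prod (forall i, W i).

Definition dep_prod_add (f g : dep_prod) : dep_prod := fun i => f i + g i.
Definition dep_prod_opp (f : dep_prod) : dep_prod := fun i => - f i.
Definition dep_prod_zero : dep_prod := fun=> 0.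

Lemma dep_prod_addA : associative dep_prod_add.
Proof. by move=> f g h; apply: functional_extensionality_dep => i; exact: addrA. Qed.
Lemma dep_prod_addC : commutative dep_prod_add.
Proof. by move=> f g; apply: functional_extensionality_dep => i; exact: addrC. Qed.
Lemma dep_prod_add0 : left_id dep_prod_zero dep_prod_add.
Proof. by move=> f; apply: functional_extensionality_dep => i; exact: add0r. Qed.
Lemma dep_prod_addN : left_inverse dep_prod_zero dep_prod_opp dep_prod_add.
Proof. by move=> f; apply: functional_extensionality_dep => i; exact: addNr. Qed.

HB.instance Definition _ := GRing.isZmodule.Build dep_prod
  dep_prod_addA dep_prod_addC dep_prod_add0 dep_prod_addN.

End DependentProduct.

Record bimod (D E : pzRingType) := Bimod {
  bm_sort :> zmodType;
  bm_l : D -> bm_sort -> bm_sort;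
  bm_r : bm_sort -> E -> bm_sort;
  bm_ax : is_bimodule bm_l bm_r
}.

Section BimodTheory.
Variables (D E : pzRingType) (A : bimod D E).

Lemma bm_lM d d' (a : A) : bm_l (d * d') a = bm_l d (bm_l d' a).
Proof. by case: (bm_ax A) => -[-> _ _ _]. Qed.
Lemma bm_l1 (a : A) : bm_l 1 a = a.
Proof. by case: (bm_ax A) => -[_ -> _ _]. Qed.
Lemma bm_lDr d (a b : A) : bm_l d (a + b) = bm_l d a + bm_l d b.
Proof. by case: (bm_ax A) => -[_ _ -> _]. Qed.
Lemma bm_lDl d d' (a : A) : bm_l (d + d') a = bm_l d a + bm_l d' a.
Proof. by case: (bm_ax A) => -[_ _ _ ->]. Qed.
Lemma bm_rM (a : A) e e' : bm_r a (e * e') = bm_r (bm_r a e) e'.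
Proof. by case: (bm_ax A) => _ [-> _ _ _]. Qed.
Lemma bm_r1 (a : A) : bm_r a 1 = a.
Proof. by case: (bm_ax A) => _ [_ -> _ _]. Qed.
Lemma bm_rDl (a b : A) e : bm_r (a + b) e = bm_r a e + bm_r b e.
Proof. by case: (bm_ax A) => _ [_ _ -> _]. Qed.
Lemma bm_rDr (a : A) e e' : bm_r a (e + e') = bm_r a e + bm_r a e'.
Proof. by case: (bm_ax A) => _ [_ _ _ ->]. Qed.
Lemma bm_lr d (a : A) e : bm_l d (bm_r a e) = bm_r (bm_l d a) e.
Proof. by case: (bm_ax A) => _ _ ->. Qed.
Lemma bm_l0r d : bm_l d (0 : A) = 0.
Proof. by apply: (addrI (bm_l d 0)); rewrite -bm_lDr !addr0. Qed.
Lemma bm_r0l e : bm_r (0 : A) e = 0.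
Proof. by apply: (addrI (bm_r 0 e)); rewrite -bm_rDl !addr0. Qed.
Lemma bm_l0 (a : A) : bm_l 0 a = 0.
Proof. by apply: (addrI (bm_l 0 a)); rewrite -bm_lDl !addr0. Qed.
Lemma bm_r0 (a : A) : bm_r a 0 = 0.
Proof. by apply: (addrI (bm_r a 0)); rewrite -bm_rDr !addr0. Qed.

Definition leftmod : Type := A.
HB.instance Definition _ := GRing.Zmodule.on leftmod.
HB.instance Definition _ := GRing.Zmodule_isLmodule.Build D leftmod
  (fun a b v => esym (bm_lM a b v)) bm_l1 bm_lDr (fun v a b => bm_lDl a b v).

Definition rightmod : Type := A.
HB.instance Definition _ := GRing.Zmodule.on rightmod.
HB.instance Definition _ := GRing.Zmodule_isLmodule.Build E^c rightmod
  (fun a b v => esym (bm_rM v b a)) bm_r1 (fun a u v => bm_rDl u v a)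
  (fun v a b => bm_rDr v a b).

End BimodTheory.

(** The additive maps that commute with a family of operators: left linear
    functionals if T acts by left multiplications, right linear ones if it acts
    by right multiplications. *)
Section Dual.
Variables (W D : zmodType) (T : Type) (s : T -> W -> W) (m : T -> D -> D).
Hypothesis mB : forall t, {morph m t : x y / x - y}.

(** The additivity of the operators is an argument so that the subgroup
    structure, whose proof relies on it, can be inferred. *)
Definition dual_pred of (forall t, {morph m t : x y / x - y}) :
    {pred dep_prod (fun _ : W => D)} :=
  fun f => `[< (forall x y, f (x + y) = f x + f y) /\
               forall t x, f (s t x) = m t (f x) >].

Lemma dual_closed : zmod_closed (dual_pred mB).
Proof.
split=> [|f g /asboolP[fD fm] /asboolP[gD gm]]; apply/asboolP; split.
- by move=> x y; rewrite -[RHS]/(0 + 0) addr0.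
- by move=> t x; rewrite -[LHS]/(0 : D) -[RHS]/(m t 0) -[in RHS](subrr 0) mB subrr.
- move=> x y; rewrite -[LHS]/(f (x + y) - g (x + y)) fD gD opprD addrACA.
  by [].
- move=> t x; rewrite -[LHS]/(f (s t x) - g (s t x)) fm gm -mB.
  by [].
Qed.

HB.instance Definition _ := GRing.isZmodClosed.Build _ (dual_pred mB) dual_closed.

Definition dual : Type := {f : dep_prod (fun _ : W => D) | f \in dual_pred mB}.
HB.instance Definition _ := Choice.on dual.
HB.instance Definition _ := SubType.on dual.
HB.instance Definition _ := [SubChoice_isSubZmodule of dual by <:].

Lemma dualD (f : dual) x y : val f (x + y) = val f x + val f y.
Proof. by case/asboolP: (valP f). Qed.
Lemma dualZ (f : dual) t x : val f (s t x) = m t (val f x).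
Proof. by case/asboolP: (valP f). Qed.
Lemma dualP (f g : dual) : (forall x, val f x = val g x) -> f = g.
Proof. by move=> fg; apply: val_inj; apply: functional_extensionality_dep. Qed.
Definition dual_mk (f : W -> D) (fD : forall x y, f (x + y) = f x + f y)
  (fm : forall t x, f (s t x) = m t (f x)) : dual :=
  Sub (f : dep_prod (fun _ : W => D)) (introT (asboolP _) (conj fD fm)).
End Dual.

Record pairing (D E : pzRingType) (A : bimod D E) (B : bimod E D) := Pairing {
  pr :> A -> B -> D;
  prDl : forall a a' b, pr (a + a') b = pr a b + pr a' b;
  prDr : forall a b b', pr a (b + b') = pr a b + pr a b';
  prl : forall d a b, pr (bm_l d a) b = d * pr a b;
  prr : forall a b d, pr a (bm_r b d) = pr a b * d;
  prm : forall a e b, pr (bm_r a e) b = pr a (bm_l e b);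
  pr_nondegl : forall a, (forall b, pr a b = 0) -> a = 0;
  pr_nondegr : forall b, (forall a, pr a b = 0) -> b = 0
}.

Section PairingTheory.
Variables (D E : pzRingType) (A : bimod D E) (B : bimod E D) (p : pairing A B).
Lemma pr0l b : p 0 b = 0.
Proof. by apply: (addrI (p 0 b)); rewrite -prDl !addr0. Qed.
Lemma pr0r a : p a 0 = 0.
Proof. by apply: (addrI (p a 0)); rewrite -prDr !addr0. Qed.
End PairingTheory.

Section Duals.
Variables (D E : unitRingType) (A : bimod D E).

Definition ldual_type :=
  @dual A D D (@bm_l D E A) (fun d x : D => d * x) (fun d => mulrBr d).

Definition ldual_l (e : E) (f : ldual_type) : ldual_type.
Proof.
apply: (dual_mk _ (f := fun a => val f (bm_r a e))).
  by move=> x y; rewrite bm_rDl dualD.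
by move=> d x; rewrite -bm_lr dualZ.
Defined.

Definition ldual_r (f : ldual_type) (d : D) : ldual_type.
Proof.
apply: (dual_mk _ (f := fun a => val f a * d)).
  by move=> x y; rewrite dualD mulrDl.
by move=> d' x; rewrite dualZ mulrA.
Defined.

Lemma ldual_ax : is_bimodule ldual_l ldual_r.
Proof.
split; first split.
- by move=> a b f; apply: dualP => x /=; rewrite bm_rM.
- by move=> f; apply: dualP => x /=; rewrite bm_r1.
- by move=> a f g; apply: dualP.
- by move=> a b f; apply: dualP => x /=; rewrite bm_rDr dualD.
- split.
  + by move=> f a b; apply: dualP => x /=; rewrite mulrA.
  + by move=> f; apply: dualP => x /=; rewrite mulr1.
  + move=> f g a; apply: dualP => x /=.
    by rewrite -[LHS]/((val f x + val g x) * a) mulrDl.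
  + move=> f a b; apply: dualP => x /=.
    by rewrite mulrDr.
- by move=> a f b; apply: dualP.
Qed.

Definition ldual : bimod E D := Bimod ldual_ax.

Definition rdual_type :=
  @dual A E E (fun e (a : A) => bm_r a e) (fun e x : E => x * e)
    (fun e x y => mulrBl e x y).

Definition rdual_l (e : E) (f : rdual_type) : rdual_type.
Proof.
apply: (dual_mk _ (f := fun a => e * val f a)).
  by move=> x y; rewrite dualD mulrDr.
by move=> d' x; rewrite (dualZ f) mulrA.
Defined.

Definition rdual_r (f : rdual_type) (d : D) : rdual_type.
Proof.
apply: (dual_mk _ (f := fun a => val f (bm_l d a))).
  by move=> x y; rewrite bm_lDr dualD.
by move=> e x; rewrite bm_lr (dualZ f).
Defined.

Lemma rdual_ax : is_bimodule rdual_l rdual_r.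
Proof.
split; first split.
- by move=> a b f; apply: dualP => x /=; rewrite mulrA.
- by move=> f; apply: dualP => x /=; rewrite mul1r.
- move=> a f g; apply: dualP => x /=.
  by rewrite -[LHS]/(a * (val f x + val g x)) mulrDr.
- move=> a b f; apply: dualP => x /=.
  by rewrite mulrDl.
- split.
  + by move=> f a b; apply: dualP => x /=; rewrite bm_lM.
  + by move=> f; apply: dualP => x /=; rewrite bm_l1.
  + by move=> f g a; apply: dualP.
  + by move=> f a b; apply: dualP => x /=; rewrite bm_lDl dualD.
- by move=> a f b; apply: dualP.
Qed.

Definition rdual : bimod E D := Bimod rdual_ax.

Lemma skew_left_inv (K : unitRingType) : skew_field K ->
  forall x : K, x != 0 -> left_invertible x.
Proof. by move=> sK x /sK ux; exists x^-1; rewrite mulVr. Qed.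

Lemma skew_right_inv (K : unitRingType) : skew_field K ->
  forall x : K^c, x != 0 -> left_invertible x.
Proof. by move=> sK x /sK ux; exists ((x : K)^-1); exact: (mulrV ux). Qed.

(** Evaluation on the left dual; [separating_functional] is what makes it
    nondegenerate in the first argument. *)
Definition ldual_pairing (sD : skew_field D) : pairing A ldual.
Proof.
apply: (@Pairing D E A ldual (fun a f => val f a)) => //.
- by move=> a a' f; exact: dualD.
- by move=> d a f; exact: (dualZ f).
- move=> a fa; apply: contrapT => /eqP a0.
  have [||f [fD fZ /eqP]] := @separating_functional D (leftmod A) _ _ a a0.
  + exact: skew_left_inv.
  + exact: oner_neq0.
  case; exact: (fa (@dual_mk A D D (@bm_l D E A) (fun d x : D => d * x)
    (fun d => mulrBr d) f fD fZ)).
- by move=> f fa; apply: dualP => x; rewrite fa.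
Defined.

(** A right E-module is a left module over the converse of E, hence the
    separating functional over E^c. *)
Definition rdual_pairing (sE : skew_field E) : pairing rdual A.
Proof.
apply: (@Pairing E D rdual A (fun f a => val f a)) => //.
- by move=> f a a'; exact: dualD.
- by move=> f a e; exact: (dualZ f).
- by move=> f fa; apply: dualP => x; rewrite fa.
- move=> a fa; apply: contrapT => /eqP a0.
  have [||f [fD fZ /eqP]] := @separating_functional E^c (rightmod A) _ _ a a0.
  + exact: skew_right_inv.
  + exact: (oner_neq0 E).
  case; exact: (fa (@dual_mk A E E (fun e (a : A) => bm_r a e)
    (fun e x : E => x * e) (fun e x y => mulrBl e x y) f fD fZ)).
Defined.

End Duals.

Section DirectSum.
Variables (I : eqType) (W : I -> zmodType).

Definition dsum_pred : {pred dep_prod W} :=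
  fun f => `[< exists s : seq I, forall i, i \notin s -> f i = 0 >].

Lemma dsum_closed : zmod_closed dsum_pred.
Proof.
split; first by apply/asboolP; exists [::].
move=> f g /asboolP[s fs] /asboolP[t gt]; apply/asboolP; exists (s ++ t) => i.
rewrite mem_cat negb_or => /andP[si ti].
by rewrite -[LHS]/(f i - g i) fs // gt // subr0.
Qed.

HB.instance Definition _ := GRing.isZmodClosed.Build _ dsum_pred dsum_closed.

Definition dsum : Type := {f : dep_prod W | f \in dsum_pred}.
HB.instance Definition _ := Choice.on dsum.
HB.instance Definition _ := SubType.on dsum.
HB.instance Definition _ := [SubChoice_isSubZmodule of dsum by <:].

Lemma dsumP (f g : dsum) : (forall i, val f i = val g i) -> f = g.
Proof. by move=> fg; apply: val_inj; apply: functional_extensionality_dep. Qed.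

Lemma dsum_support (f : dsum) : exists s, uniq s /\ forall i, i \notin s -> val f i = 0.
Proof.
have /asboolP[s fs] := valP f; exists (undup s); split; first exact: undup_uniq.
by move=> i; rewrite mem_undup; exact: fs.
Qed.

(** Some finite set that contains the support; [dsum_sumE] shows that sums over
    it do not depend on its choice. *)
Definition dsum_supp (f : dsum) : seq I := projT1 (cid (dsum_support f)).

Lemma dsum_suppP (f : dsum) i : i \notin dsum_supp f -> val f i = 0.
Proof. exact: (projT2 (cid (dsum_support f))).2. Qed.

Lemma dsum_supp_uniq (f : dsum) : uniq (dsum_supp f).
Proof. exact: (projT2 (cid (dsum_support f))).1. Qed.

Lemma dirac_in i (x : W i) : (dfwith (fun j => 0 : W j) x : dep_prod W) \in dsum_pred.
Proof.
apply/asboolP; exists [:: i] => j; rewrite inE eq_sym => ij.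
by rewrite dfwith_out.
Qed.

Definition dirac i (x : W i) : dsum :=
  Sub (dfwith (fun j => 0 : W j) x : dep_prod W) (dirac_in x).

Lemma dirac_self i (x : W i) : val (dirac x) i = x.
Proof. by rewrite /= dfwith_in. Qed.

Lemma dirac_out i (x : W i) j : i != j -> val (dirac x) j = 0.
Proof. by move=> ij; rewrite /= dfwith_out. Qed.

Definition dsum_mk (f : dep_prod W) (g : dsum)
  (fg : forall i, val g i = 0 -> f i = 0) : dsum.
Proof.
apply: (Sub f); apply/asboolP; exists (dsum_supp g) => i /dsum_suppP; exact: fg.
Defined.

Variables (D : zmodType) (phi : forall i, W i -> D).
Hypothesis phi0 : forall i, phi (0 : W i) = 0.

Definition dsum_sum (f : dsum) : D := \sum_(i <- dsum_supp f) phi (val f i).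

Lemma dsum_sumE (f : dsum) s : uniq s -> (forall i, i \notin s -> val f i = 0) ->
  dsum_sum f = \sum_(i <- s) phi (val f i).
Proof.
move=> us fs; rewrite /dsum_sum; set t := dsum_supp f.
rewrite (bigID (mem s)) /= [X in _ + X]big1 ?addr0 => [|i /fs ->//].
rewrite [RHS](bigID (mem t)) /= [X in _ + X]big1 ?addr0 => [|i /dsum_suppP ->//].
rewrite -[LHS]big_filter -[RHS]big_filter; apply: perm_big.
apply: uniq_perm; rewrite ?filter_uniq ?dsum_supp_uniq // => i.
by rewrite !mem_filter andbC.
Qed.

End DirectSum.

Section DirectSumBimod.
Variables (I : eqType) (D E : pzRingType) (A : I -> bimod D E).

Definition dsum_l (d : D) (f : dsum A) : dsum A.
Proof.
by apply: (@dsum_mk _ _ (fun i => bm_l d (val f i)) f) => i ->; exact: bm_l0r.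
Defined.

Definition dsum_r (f : dsum A) (e : E) : dsum A.
Proof.
by apply: (@dsum_mk _ _ (fun i => bm_r (val f i) e) f) => i ->; exact: bm_r0l.
Defined.

Lemma dsum_ax : is_bimodule dsum_l dsum_r.
Proof.
split; first split.
- by move=> a b f; apply: dsumP => i /=; rewrite bm_lM.
- by move=> f; apply: dsumP => i /=; rewrite bm_l1.
- by move=> a f g; apply: dsumP => i; exact: bm_lDr.
- by move=> a b f; apply: dsumP => i; exact: bm_lDl.
- split.
  + by move=> f a b; apply: dsumP => i /=; rewrite bm_rM.
  + by move=> f; apply: dsumP => i /=; rewrite bm_r1.
  + by move=> f g a; apply: dsumP => i; exact: bm_rDl.
  + by move=> f a b; apply: dsumP => i; exact: bm_rDr.
- by move=> a f b; apply: dsumP => i /=; rewrite bm_lr.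
Qed.

Definition dsum_bimod : bimod D E := Bimod dsum_ax.

End DirectSumBimod.

(** Member i of the first family is paired with member s i of the second one.
    In the chain of duals below, s is the identity for one pairing and the
    successor for the other one. *)
Section DirectSumPairing.
Variables (I : eqType) (D E : pzRingType).
Variables (A : I -> bimod D E) (B : I -> bimod E D) (s s' : I -> I).
Hypotheses (sK : cancel s s') (s'K : cancel s' s).
Variable p : forall i, pairing (A i) (B (s i)).

Definition dsum_pr (u : dsum A) (v : dsum B) : D :=
  dsum_sum (fun i x => p i x (val v (s i))) u.

Lemma dsum_prE (u : dsum A) (v : dsum B) t : uniq t ->
  (forall i, i \notin t -> val u i = 0) ->
  dsum_pr u v = \sum_(i <- t) p i (val u i) (val v (s i)).
Proof. by apply: dsum_sumE => i; exact: pr0l. Qed.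

Lemma common_support (u u' : dsum A) : exists t, [/\ uniq t,
  forall i, i \notin t -> val u i = 0 & forall i, i \notin t -> val u' i = 0].
Proof.
exists (undup (dsum_supp u ++ dsum_supp u')); split; first exact: undup_uniq.
all: move=> i; rewrite mem_undup mem_cat negb_or => /andP[iu iu'].
  exact: dsum_suppP.
exact: dsum_suppP.
Qed.

Lemma dsum_pr_dirac_l i (x : A i) v : dsum_pr (dirac x) v = p i x (val v (s i)).
Proof.
rewrite (@dsum_prE _ _ [:: i]) ?big_seq1 ?dirac_self // => j.
by rewrite inE eq_sym; exact: dirac_out.
Qed.

Lemma dsum_pr_dirac_r u i (y : B (s i)) : dsum_pr u (dirac y) = p i (val u i) y.
Proof.
pose t := undup (i :: dsum_supp u).
have ti : i \in t by rewrite mem_undup mem_head.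
rewrite (@dsum_prE _ _ t) ?undup_uniq //; last first.
  by move=> j; rewrite mem_undup inE negb_or => /andP[_]; exact: dsum_suppP.
rewrite (bigD1_seq i) ?undup_uniq //= dfwith_in big1 ?addr0 // => j ji.
rewrite dfwith_out ?pr0r //.
by apply: contra_neq ji => /(can_inj sK).
Qed.

Definition dsum_pairing : pairing (dsum_bimod A) (dsum_bimod B).
Proof.
apply: (@Pairing D E (dsum_bimod A) (dsum_bimod B) dsum_pr).
- move=> u u' v; have [t [ut tu tu']] := common_support u u'.
  rewrite !(dsum_prE v ut) //; last first.
    by move=> i it /=; rewrite -[LHS]/(val u i + val u' i) tu // tu' // addr0.
  by rewrite -big_split /=; apply: eq_bigr => i _; rewrite -prDl.
- move=> u v v'; rewrite !(dsum_prE _ (dsum_supp_uniq u) (@dsum_suppP _ _ u)).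
  by rewrite -big_split /=; apply: eq_bigr => i _; rewrite -prDr.
- move=> d u v; rewrite !(dsum_prE _ (dsum_supp_uniq u)); last 2 first.
  + exact: dsum_suppP.
  + by move=> i /dsum_suppP /= ->; exact: bm_l0r.
  by rewrite mulr_sumr; apply: eq_bigr => i _; rewrite -prl.
- move=> u v d; rewrite !(dsum_prE _ (dsum_supp_uniq u) (@dsum_suppP _ _ u)).
  by rewrite mulr_suml; apply: eq_bigr => i _; rewrite -prr.
- move=> u e v; rewrite !(dsum_prE _ (dsum_supp_uniq u)); last 2 first.
  + exact: dsum_suppP.
  + by move=> i /dsum_suppP /= ->; exact: bm_r0l.
  by apply: eq_bigr => i _; rewrite -prm.
- move=> u u0; apply: dsumP => i.
  apply: etrans (_ : 0 = _) => //; apply: (@pr_nondegl _ _ _ _ (p i)) => y.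
  by rewrite -dsum_pr_dirac_r.
- move=> v v0; apply: dsumP => j; rewrite -[j]s'K.
  apply: etrans (_ : 0 = _) => //; apply: (@pr_nondegr _ _ _ _ (p (s' j))) => x.
  by rewrite -dsum_pr_dirac_l.
Defined.

End DirectSumPairing.

(** The chain V_(-1), U_0 = X, V_0, U_1, V_1, and so on in both directions. To
    the right of X each member is the left dual of the previous one, to the
    left of X each member is the right dual of the next one; so U i is paired
    with V i with values in D, and V i with U (i + 1) with values in E. *)
Section DualChain.
Variables (D E : unitRingType) (X : bimod D E).
Hypotheses (skewD : skew_field D) (skewE : skew_field E).

(** The successor on the integers, defined by cases so that
    [chainU (chain_next i)] computes on the constructors. *)
Definition chain_next (i : int) : int :=
  match i with Posz m => Posz m.+1 | Negz 0 => Posz 0 | Negz m.+1 => Negz m end.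
Definition chain_prev (i : int) : int :=
  match i with Posz 0 => Negz 0 | Posz m.+1 => Posz m | Negz m => Negz m.+1 end.
Lemma chain_nextK : cancel chain_next chain_prev. Proof. by case=> [|[]]. Qed.
Lemma chain_prevK : cancel chain_prev chain_next. Proof. by case=> [[]|]. Qed.

Definition right_chain m : bimod D E := iter m (fun Y => ldual (ldual Y)) X.
Definition left_chain m : bimod E D := iter m (fun Y => rdual (rdual Y)) (rdual X).

Definition chainU (i : int) : bimod D E :=
  match i with Posz m => right_chain m | Negz m => rdual (left_chain m) end.
Definition chainV (i : int) : bimod E D :=
  match i with Posz m => ldual (right_chain m) | Negz m => left_chain m end.

Definition chainUV (i : int) : pairing (chainU i) (chainV (id i)).
Proof. by case: i => m; [exact: ldual_pairing | exact: rdual_pairing]. Defined.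

Definition chainVU (i : int) : pairing (chainV i) (chainU (chain_next i)).
Proof.
by case: i => [m|[|m]]; [exact: ldual_pairing | exact: rdual_pairing |
  exact: rdual_pairing].
Defined.

Lemma dual_pair : (exists x : X, x != 0) ->
  exists (U : bimod D E) (V : bimod E D) (p : pairing U V) (q : pairing V U)
    (u : U), u != 0.
Proof.
move=> [x x0].
exists (dsum_bimod chainU), (dsum_bimod chainV).
exists (dsum_pairing (s := id) (s' := id) (fun=> erefl) (fun=> erefl) chainUV).
exists (dsum_pairing chain_nextK chain_prevK chainVU).
exists (dirac (W := chainU) (i := Posz 0) x).
apply: contra_neq x0 => u0.
by rewrite -[x](@dirac_self _ chainU (Posz 0)) u0.
Qed.

End DualChain.

(** * The residue maps and the socle embeddings of a formal matrix ring *)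

(** What gluing uses of a formal matrix ring F with Nakayama permutation pi:
    the residue maps [rho], which vanish off the diagonal, and embeddings
    [gam i (pi i)] of K onto the socle of the pairing bimodules, which on both
    sides contain all elements killed by the radical. Both families are
    extended by 0 to all positions; so their rules need no cases. *)
Record socle_data (n : nat) (F : formal_data n) (pi : 'S_n) (K : unitRingType) :=
SocleData {
  rho : forall i j, F i j -> K;
  gam : forall i j, K -> F i j;
  rhoD : forall i j (a b : F i j), rho (a + b) = rho a + rho b;
  rhoM : forall i j k (a : F i j) (b : F j k), rho (fm_mul a b) = rho a * rho b;
  rho1 : forall i, rho (fm_one F i) = 1;
  rho_rad : forall i j (a : F i j), fm_rad a <-> rho a = 0;
  rho_surj : forall i x, exists a : F i i, rho a = x;
  gamD : forall i j x y, gam i j (x + y) = gam i j x + gam i j y;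
  gam_l : forall i j k (a : F i j) x, fm_mul a (gam j k x) = gam i k (rho a * x);
  gam_r : forall i j k (b : F j k) x, fm_mul (gam i j x) b = gam i k (x * rho b);
  rho_gam : forall i j x, rho (gam i j x) = 0;
  gam_inj : forall i x, gam i (pi i) x = 0 -> x = 0;
  gam_off : forall i j x, j != pi i -> gam i j x = 0;
  right_gam : forall i j (a : F i j), right_socle a -> exists x, a = gam i j x;
  left_gam : forall i j (a : F i j), left_socle a -> exists x, a = gam i j x
}.

Lemma soc_sub (A : pzRingType) (V : lmodType A) (X : {pred V}) :
  submod_closed X -> {subset soc X <= X}.
Proof.
by move=> cX x /asboolP/(_ X cX); apply=> y [N [_ NX Ny]]; exact: NX.
Qed.

Section Annihilated.
Variables (n : nat) (F : formal_data n) (i j : 'I_n).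

Lemma left_annihilated_closed :
  submod_closed (left_annihilated F i j : {pred fm_entryL F i j}).
Proof.
split; first by apply/asboolP => h _ b; rewrite fm_mul0r.
move=> a x y /asboolP hx /asboolP hy; apply/asboolP => h hi b.
rewrite -[_ + _]/(fm_mul (a : F i i) x + y : F i j) fm_mulDr hy // addr0.
by rewrite -fm_mulA; exact: (hx h hi).
Qed.

End Annihilated.

Lemma right_annihilated_closed (n : nat) (F : formal_data n) (i j : 'I_n) :
  submod_closed (right_annihilated F i j : {pred fm_entryR F i j}).
Proof.
split; first by apply/asboolP => h _ b; rewrite fm_mul0l.
move=> a x y /asboolP hx /asboolP hy; apply/asboolP => h hi b.
rewrite -[_ + _]/(fm_mul x (a : F j j) + y : F i j) fm_mulDl hy // addr0.
by rewrite fm_mulA; exact: (hx h hi).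
Qed.

Section SocleData.
Variables (n : nat) (S : formal_matrix_ring n) (sigma : 'S_n) (K : unitRingType).
Hypotheses (basicS : basic S) (nakS : nakayama_permutation S sigma).
Hypothesis skewK : skew_field K.
Variable phi : forall i, {rmorphism residue (fm_corner S i) -> K}.
Hypothesis phi_bij : forall i, bijective (phi i).
Hypothesis pairing_soc : forall i : 'I_n,
  pairing_socR S i (sigma i) =i pairing_socL S i (sigma i) /\
  residue_bimodule_iso (pairing_socL S i (sigma i)) (phi i) (phi (sigma i)).
Hypothesis nonsimple : forall i : 'I_n, sigma i = i -> ~ simple_ring (fm_corner S i).

Let loc := @fm_local n S.
Let sbS : strictly_basic S := (basicP S).1 basicS.

Definition ext_residue i j (a : S i j) : K :=
  if i =P j is ReflectT e
  then phi i (residue_proj (ecast k (S i k) (esym e) a : fm_corner S i)) else 0.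

Lemma ext_residue_diag i (a : S i i) : ext_residue a = phi i (residue_proj (a : fm_corner S i)).
Proof. by rewrite /ext_residue; case: eqP => // e; rewrite (eq_axiomK e). Qed.

Lemma ext_residue_off i j (a : S i j) : i != j -> ext_residue a = 0.
Proof. by rewrite /ext_residue; case: eqP. Qed.

Lemma residue_proj_eq0 (A : pzRingType) (x : A) :
  residue_proj x = 0 <-> x \in jacobson A.
Proof.
have p0 : residue_proj (0 : A) = 0.
  by apply: (addrI (residue_proj 0)); rewrite -residue_projD !addr0.
by rewrite -[X in _ = X]p0 residue_projE subr0.
Qed.

Lemma ext_residue_rad i j (a : S i j) : fm_rad a <-> ext_residue a = 0.
Proof.
case: (eqVneq i j) a => [<-|ij] a; last by split=> _; [exact: ext_residue_off | exact: sbS].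
rewrite (rad_local loc) ext_residue_diag -residue_proj_eq0.
split=> [->|h]; first exact: rmorph0.
by apply: (bij_inj (phi_bij i)); rewrite rmorph0.
Qed.

Lemma ext_residueD i j (a b : S i j) : ext_residue (a + b) = ext_residue a + ext_residue b.
Proof.
case: (eqVneq i j) a b => [<-|ij] a b; last by rewrite !ext_residue_off // addr0.
by rewrite !ext_residue_diag residue_projD rmorphD.
Qed.

(** For i = k distinct from j this says that the product of an element at
    (i, j) and an element at (j, i) is in the radical, as S is basic. *)
Lemma ext_residueM i j k (a : S i j) (b : S j k) :
  ext_residue (fm_mul a b) = ext_residue a * ext_residue b.
Proof.
case: (eqVneq i j) a => [<-|ij] a in b *; last first.
  rewrite (ext_residue_off a) // mul0r; apply/ext_residue_rad.
  by apply: (rad_mulr loc); exact: sbS.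
case: (eqVneq i k) b => [<-|ik] b; last by rewrite !(@ext_residue_off i k) // mulr0.
rewrite !ext_residue_diag -rmorphM; congr (phi i _); exact: residue_projM.
Qed.

Lemma ext_residue1 i : ext_residue (fm_one S i) = 1.
Proof. by rewrite ext_residue_diag -[residue_proj _]/(1 : residue _) rmorph1. Qed.

Lemma ext_residue_surj i x : exists a : S i i, ext_residue a = x.
Proof.
have [psi _ psiK] := phi_bij i; exists (repr (psi x) : fm_corner S i).
by rewrite ext_residue_diag residue_projK psiK.
Qed.

Definition socle_map i : K -> S i (sigma i) := projT1 (cid (pairing_soc i).2).

Lemma socle_mapP i : [/\ injective (@socle_map i), {morph @socle_map i : x y / x + y},
  forall m, (m \in pairing_socL S i (sigma i)) <-> (exists x, m = socle_map i x),
  forall (s : S i i) x, socle_map i (ext_residue s * x) = fm_mul s (socle_map i x) &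
  forall x (t : S (sigma i) (sigma i)),
    socle_map i (x * ext_residue t) = fm_mul (socle_map i x) t].
Proof.
rewrite /socle_map; case: cid => g /= [gI gD gT gl gr]; split => // [s x|x t].
  by rewrite ext_residue_diag; exact: gl.
by rewrite ext_residue_diag; exact: gr.
Qed.

Definition ext_socle i j (x : K) : S i j :=
  if j =P sigma i is ReflectT e then ecast l (S i l) (esym e) (socle_map i x) else 0.

Lemma ext_socle_diag i x : ext_socle i (sigma i) x = socle_map i x.
Proof. by rewrite /ext_socle; case: eqP => // e; rewrite (eq_axiomK (esym e)). Qed.

Lemma ext_socle_off i j x : j != sigma i -> ext_socle i j x = 0.
Proof. by rewrite /ext_socle; case: eqP. Qed.

Lemma ext_socleD i j x y : ext_socle i j (x + y) = ext_socle i j x + ext_socle i j y.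
Proof.
have [->|ji] := eqVneq j (sigma i); last by rewrite !ext_socle_off // addr0.
by rewrite !ext_socle_diag; case: (socle_mapP i) => _ ->.
Qed.

Lemma ext_socle0 i j : ext_socle i j 0 = 0.
Proof. by apply: (addrI (ext_socle i j 0)); rewrite -ext_socleD !addr0. Qed.

Lemma ext_socle_inj i x : ext_socle i (sigma i) x = 0 -> x = 0.
Proof.
rewrite -(ext_socle0 i (sigma i)) !ext_socle_diag; by case: (socle_mapP i) => gI _ _ _ _ /gI.
Qed.

(** For i distinct from j both sides vanish, the left one since the socle lies
    in the left annihilator of the entries off the diagonal. *)
Lemma ext_socle_l i j k (a : S i j) x :
  fm_mul a (ext_socle j k x) = ext_socle i k (ext_residue a * x).
Proof.
case: (eqVneq i j) a => [<-|ij] a.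
  have [->|ji] := eqVneq k (sigma i); last by rewrite !ext_socle_off // fm_mul0r.
  by rewrite !ext_socle_diag; case: (socle_mapP i) => _ _ _ ->.
rewrite ext_residue_off // mul0r ext_socle0.
have [->|ji] := eqVneq k (sigma j); last by rewrite !ext_socle_off // fm_mul0r.
rewrite ext_socle_diag.
have /(soc_sub (@left_annihilated_closed _ S j (sigma j)))/asboolP :
    socle_map j x \in pairing_socL S j (sigma j).
  by case: (socle_mapP j) => _ _ -> _ _; exists x.
by apply.
Qed.

Lemma ext_socle_r i j k (b : S j k) x :
  fm_mul (ext_socle i j x) b = ext_socle i k (x * ext_residue b).
Proof.
have [ej|ji] := eqVneq j (sigma i); last first.
  rewrite ext_socle_off // fm_mul0l.
  case: (eqVneq j k) b => [<-|jk] b; first by rewrite ext_socle_off.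
  by rewrite ext_residue_off // mulr0 ext_socle0.
subst j; rewrite ext_socle_diag.
case: (eqVneq (sigma i) k) b => [<-|jk] b.
  by rewrite ext_socle_diag; case: (socle_mapP i) => _ _ _ _ ->.
rewrite ext_residue_off // mulr0 ext_socle0.
have /(soc_sub (@right_annihilated_closed _ S i (sigma i)))/asboolP :
    socle_map i x \in pairing_socR S i (sigma i).
  by rewrite (pairing_soc i).1; case: (socle_mapP i) => _ _ -> _ _; exists x.
by apply; rewrite eq_sym.
Qed.

(** Only a fixed point i of sigma is at stake. If an element of the socle were
    a unit of the corner at i, the corner would be the image of K under
    [ext_socle i i], and then every nonzero element of it would generate the
    unit ideal: the corner would be simple. *)
Lemma ext_residue_socle i j x : ext_residue (ext_socle i j x) = 0.
Proof.
case: (eqVneq i j) => [<-|]; last exact: ext_residue_off.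
have [si|si] := eqVneq i (sigma i); last first.
  by apply/ext_residue_rad; rewrite ext_socle_off //; exact: (rad0 loc).
apply/ext_residue_rad; have [//|[b ba]] := rad_or_invertible (ext_socle i i x).
case: (nonsimple (esym si)); rewrite ext_socle_l in ba.
split; first exact: (fm_one_neq0 loc).
move=> I [zI Il _].
have [[y Iy y0]|no] := pselect (exists2 y, y \in I & y != 0); last first.
  by left => y Iy; apply: contrapT => /eqP y0; apply: no; exists y.
right; have yE : y = ext_socle i i (ext_residue (y : S i i) * (ext_residue b * x)).
  by rewrite -ext_socle_l ba fm_mul1r.
set z := ext_residue y * _ in yE.
have z0 : z != 0 by apply: contraNneq y0 => z0; rewrite yE z0 ext_socle0.
have [a az] := ext_residue_surj i (ext_residue b * x * z^-1).
have <- : (a : fm_corner S i) * y = 1.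
  rewrite -[LHS]/(fm_mul a (y : S i i)) yE ext_socle_l az.
  by rewrite divrK ?ba //; exact: skewK.
exact: Il.
Qed.

(** The Nakayama condition gives some generator t of the elements killed by the
    radical. The image u of 1 is one of them, so u = t r; here r is invertible,
    as otherwise u = 0. Hence u is a generator as well. *)
Lemma right_socle_ext i j (a : S i j) : right_socle a -> exists x, a = ext_socle i j x.
Proof.
have [[t [t0 st gen]] _] := (nakayamaP sigma sbS).1 nakS i.
pose u := ext_socle i (sigma i) 1.
have su : right_socle u.
  by move=> k b /ext_residue_rad rb; rewrite ext_socle_r rb mulr0 ext_socle0.
have [r ur] := gen _ u su.
have [rr|[b br]] := rad_or_invertible r.
  have /eqP := oner_neq0 K; case.
  by apply: (@ext_socle_inj i); rewrite -/u ur; exact: st.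
have tE : t = fm_mul u b.
  by rewrite ur fm_mulA (fm_left_inverse loc br) fm_mul1r.
move=> /gen[s ->]; exists (1 * ext_residue (fm_mul b s)).
by rewrite tE fm_mulA ext_socle_r.
Qed.

Lemma left_socle_ext i j (a : S i j) : left_socle a -> exists x, a = ext_socle i j x.
Proof.
have [h jh] : exists h, j = sigma h by exists ((sigma^-1)%g j); rewrite permKV.
subst j; have [_ [t [t0 st gen]]] := (nakayamaP sigma sbS).1 nakS h.
pose u := ext_socle h (sigma h) 1.
have su : left_socle u.
  by move=> k b /ext_residue_rad rb; rewrite ext_socle_l rb mul0r ext_socle0.
have [r ur] := gen _ u su.
have [rr|[b br]] := rad_or_invertible r.
  have /eqP := oner_neq0 K; case.
  by apply: (@ext_socle_inj h); rewrite -/u ur; exact: st.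
have tE : t = fm_mul b u.
  by rewrite ur -fm_mulA br fm_mul1l.
move=> /gen[s ->]; exists (ext_residue (fm_mul s b) * 1).
by rewrite tE -fm_mulA ext_socle_l.
Qed.

Definition socle_data_of : socle_data S sigma K :=
  SocleData ext_residueD ext_residueM ext_residue1 ext_residue_rad
    ext_residue_surj ext_socleD ext_socle_l ext_socle_r ext_residue_socle
    ext_socle_inj ext_socle_off right_socle_ext left_socle_ext.

End SocleData.

(** * Corner rings and indecomposability of formal matrix rings *)

(** A diagonal idempotent f, the sum of the e_i over the image of iota, cuts out
    the formal matrix ring on the indices in this image. The maps [theta]
    identify its entries with those of G, since in general the two types agree
    only up to an equality of indices. *)
Section CornerIso.
Variables (N m : nat) (F : formal_data N) (G : formal_data m).
Variable iota : 'I_m -> 'I_N.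
Hypothesis iota_inj : injective iota.
Variable theta : forall i j, F (iota i) (iota j) -> G i j.
Variable theta' : forall i j, G i j -> F (iota i) (iota j).
Hypothesis thetaK : forall i j, cancel (@theta i j) (@theta' i j).
Hypothesis theta'K : forall i j, cancel (@theta' i j) (@theta i j).
Hypothesis thetaD : forall i j, {morph @theta i j : x y / x + y}.
Hypothesis thetaM : forall i j k (a : F (iota i) (iota j)) (b : F (iota j) (iota k)),
  theta (fm_mul a b) = fm_mul (theta a) (theta b).
Hypothesis theta1 : forall i, theta (fm_one F (iota i)) = fm_one G i.

Variables (f : fm_matrix F) (ff : f * f = f).
Hypothesis fE : forall i j, fmx_at f i j = if i \in codom iota then fm_id F i j else 0.

Let theta0 i j : theta (0 : F (iota i) (iota j)) = 0.
Proof. by apply: (addrI (theta 0)); rewrite -thetaD !addr0. Qed.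

Let mul_f x i j : fmx_at (x * f) i j = if j \in codom iota then fmx_at x i j else 0.
Proof.
rewrite fmx_atM; case: ifP => jf.
  rewrite -[RHS](mul_idE j (fun l => fmx_at x i l)); apply: eq_bigr => l _.
  rewrite fE; case: ifP => // lf; rewrite fm_id_off //.
  by apply: contraFneq lf => ->.
apply: big1 => l _; rewrite fE; case: ifP => lf; last exact: fm_mul0r.
by rewrite fm_id_off ?fm_mul0r //; apply: contraTneq lf => ->; rewrite jf.
Qed.

Let f_mul x i j : fmx_at (f * x) i j = if i \in codom iota then fmx_at x i j else 0.
Proof.
rewrite fmx_atM; case: ifP => jf.
  rewrite -[RHS](id_mulE i (fun l => fmx_at x l j)); apply: eq_bigr => l _.
  by rewrite fE jf.
by apply: big1 => l _; rewrite fE jf fm_mul0l.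
Qed.

Let at_corner (x : corner_ring ff) i j :
  (i \notin codom iota) || (j \notin codom iota) -> fmx_at (val x) i j = 0.
Proof.
have [fx xf] := peirce_id ff (valP x).
case/orP => /negPf h; first by rewrite -[X in fmx_at X]fx f_mul h.
by rewrite -[X in fmx_at X]xf mul_f h.
Qed.

Definition restrict (x : corner_ring ff) : fm_matrix G :=
  fmx (fun i j => theta (fmx_at (val x) (iota i) (iota j))).

Let restrictD : {morph restrict : x y / x + y}.
Proof.
by move=> x y; apply: fm_matrixP => i j; rewrite fmx_addE !fmxE -thetaD -fmx_addE.
Qed.

Let restrictM : {morph restrict : x y / x * y}.
Proof.
move=> x y; apply: fm_matrixP => i k; rewrite fmx_atM fmxE.
rewrite -[val (x * y)]/(val x * val y) fmx_atM.
under [RHS]eq_bigr do rewrite !fmxE -thetaM.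
rewrite (bigID (mem (codom iota))) /= [X in _ + X]big1 ?addr0; last first.
  by move=> j jN; rewrite at_corner ?jN ?orbT // fm_mul0l.
rewrite -big_uniq /=; last by rewrite map_inj_uniq // enum_uniq.
rewrite big_map big_enum /=.
by apply: (big_morph (@theta i k)); [exact: thetaD | exact: theta0].
Qed.

Let restrict1 : restrict 1 = 1.
Proof.
apply: fm_matrixP => i j; rewrite !fmxE.
have -> : val (1 : corner_ring ff) = f by [].
rewrite fE codom_f.
case: (eqVneq i j) => [<-|ij]; first by rewrite !fm_id_diag theta1.
by rewrite !fm_id_off // (inj_eq iota_inj).
Qed.

Let extend (y : fm_matrix G) : fm_matrix F :=
  \sum_i \sum_j single (theta' (fmx_at y i j)).

Let extendE y i j : fmx_at (extend y) (iota i) (iota j) = theta' (fmx_at y i j).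
Proof.
rewrite fmx_at_sum (bigD1 i) //= fmx_at_sum (bigD1 j) //= singleE.
rewrite big1 => [|k kj]; last by rewrite single_off_col // (inj_eq iota_inj) eq_sym.
rewrite big1 ?addr0 // => k ki; rewrite fmx_at_sum big1 // => l _.
by rewrite single_off_row // (inj_eq iota_inj) eq_sym.
Qed.

Let extend_corner y : extend y \in peirce f.
Proof.
apply/asboolP; exists (extend y); rewrite /extend mulr_sumr mulr_suml.
apply: eq_bigr => i _; rewrite mulr_sumr mulr_suml; apply: eq_bigr => j _.
apply: fm_matrixP => k l; rewrite mul_f f_mul.
case: ifP => [lf|lf]; last first.
  by rewrite single_off_col //; apply: contraFneq lf => ->; exact: codom_f.
case: ifP => // kf.
by rewrite single_off_row //; apply: contraFneq kf => ->; exact: codom_f.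
Qed.

Lemma corner_iso : ring_iso (corner_ring ff) (fm_matrix G).
Proof.
have restrict0 : restrict 0 = 0.
  by apply: (addrI (restrict 0)); rewrite -restrictD !addr0.
pose addm := GRing.isNmodMorphism.Build _ _ restrict (pair restrict0 restrictD).
pose mulm := GRing.isMonoidMorphism.Build _ _ restrict (pair restrict1 restrictM).
pose h : {rmorphism corner_ring ff -> fm_matrix G} := HB.pack restrict addm mulm.
exists h; exists (fun y => Sub (extend y) (extend_corner y)) => [x|y].
  apply: val_inj => /=; apply: fm_matrixP => k l.
  have [/codomP[i ->]|kN] := boolP (k \in codom iota); last first.
    rewrite (@at_corner x) ?kN //.
    by rewrite (@at_corner (Sub (extend (restrict x)) (extend_corner _))) ?kN.
  have [/codomP[j ->]|lN] := boolP (l \in codom iota); last first.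
    rewrite (@at_corner x) ?lN ?orbT //.
    by rewrite (@at_corner (Sub (extend (restrict x)) (extend_corner _))) ?lN ?orbT.
  by rewrite extendE fmxE thetaK.
by apply: fm_matrixP => i j; rewrite fmxE extendE theta'K.
Qed.

End CornerIso.

(** A central idempotent c is diagonal, and its diagonal entries are
    idempotents of local rings, hence 0 or 1. A nonzero a at (k, l) satisfies
    c_kk a = a c_ll, so c_kk = c_ll. *)
Lemma connected_indecomposable (N : nat) (F : formal_matrix_ring N) (i0 j0 : 'I_N) :
  (exists a : F i0 j0, a != 0) ->
  (forall k, (exists a : F k j0, a != 0) \/ (exists a : F i0 k, a != 0)) ->
  indecomposable_ring (fm_matrix F).
Proof.
move=> link0 link [B [C [f [g fK gK]]]].
pose c : fm_matrix F := g (1, 0).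
have cc : c * c = c.
  by apply: (can_inj fK); rewrite rmorphM !gK; congr pair; rewrite ?mulr1 ?mulr0.
have cx x : c * x = x * c.
  apply: (can_inj fK); rewrite !rmorphM !gK; case: (f x) => a b.
  by congr pair; rewrite /= ?mulr1 ?mul1r ?mulr0 ?mul0r.
have c0 : c != 0.
  apply/eqP => /(congr1 f); rewrite gK rmorph0 => -[] /eqP.
  by rewrite oner_eq0.
have c1 : c != 1.
  apply/eqP => /(congr1 f); rewrite gK rmorph1 => -[] /eqP.
  by rewrite eq_sym oner_eq0.
have off k l : k != l -> fmx_at c k l = 0.
  move=> kl; have := congr1 (fun z => fmx_at z k l) (cx (fmx_idem F k)).
  by rewrite mul_idemE idem_mulE eqxx eq_sym (negPf kl).
have diag k : fmx_at c k k = 0 \/ fmx_at c k k = fm_one F k.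
  apply: (local_idempotent (fm_local F k) (x := fmx_at c k k)).
  rewrite -[RHS](congr1 (fun z => fmx_at z k k) cc) fmx_atM (bigD1 k) //=.
  by rewrite big1 ?addr0 // => j jk; rewrite off ?fm_mul0l // eq_sym.
have one0 k : fm_one F k <> 0 by apply/eqP/(fm_one_neq0 (@fm_local _ F)).
have linked k l : (exists a : F k l, a != 0) -> fmx_at c k k = 0 <-> fmx_at c l l = 0.
  move=> [a /eqP a0].
  have := congr1 (fun z => fmx_at z k l) (cx (single a)).
  rewrite fmx_at_mul_single fmx_at_single_mul !fm_id_diag fm_mul1l fm_mul1r.
  have [ck|ck] := diag k; have [cl|cl] := diag l; rewrite ck cl => ca.
  - by [].
  - by case: a0; rewrite -[a]fm_mul1r -ca fm_mul0l.
  - by case: a0; rewrite -[a]fm_mul1l ca fm_mul0r.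
  - by split=> /one0.
have all0 k : fmx_at c k k = 0 <-> fmx_at c i0 i0 = 0.
  have l0 := linked _ _ link0.
  case: (link k) => /linked lk; last by rewrite lk.
  by rewrite lk l0.
have [ci|ci] := diag i0.
  case/eqP: c0; apply: fm_matrixP => k l; rewrite fmx_at0.
  have [<-|kl] := eqVneq k l; [exact/all0 | exact: off].
case/eqP: c1; apply: fm_matrixP => k l; rewrite fmxE.
have [<-|kl] := eqVneq k l; last by rewrite fm_id_off // off.
rewrite fm_id_diag; case: (diag k) => // /all0; rewrite ci => /one0.
by [].
Qed.

(** * Gluing two formal matrix rings *)

Section Glue.
Variables (n n' : nat) (S : formal_matrix_ring n) (S' : formal_matrix_ring n').
Variables (sigma : 'S_n) (sigma' : 'S_n') (K L : unitRingType).
Variables (d : socle_data S sigma K) (d' : socle_data S' sigma' L).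
Variables (U : bimod K L) (V : bimod L K) (p : pairing U V) (q : pairing V U).

(** The entries are defined by cases over the sum of the two index types, where
    products compute, and transported to 'I_(n + n') by [split]. *)
Definition side := ('I_n + 'I_n')%type.

Definition gl_entry (x y : side) : zmodType :=
  match x, y with
  | inl i, inl j => S i j
  | inl _, inr _ => U
  | inr _, inl _ => V
  | inr i, inr j => S' i j
  end.

Definition gl_mul (x y z : side) : gl_entry x y -> gl_entry y z -> gl_entry x z :=
  match x, y, z return gl_entry x y -> gl_entry y z -> gl_entry x z with
  | inl i, inl j, inl k => fun a b => fm_mul a b
  | inl i, inl j, inr k => fun a u => bm_l (rho d a) u
  | inl i, inr j, inl k => fun u v => gam d i k (p u v)
  | inl i, inr j, inr k => fun u b => bm_r u (rho d' b)
  | inr i, inl j, inl k => fun v a => bm_r v (rho d a)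
  | inr i, inl j, inr k => fun v u => gam d' i k (q v u)
  | inr i, inr j, inl k => fun b v => bm_l (rho d' b) v
  | inr i, inr j, inr k => fun a b => fm_mul a b
  end.

Definition gl_one (x : side) : gl_entry x x :=
  match x with inl i => fm_one S i | inr i => fm_one S' i end.

Lemma gl_mulDl x y z (a b : gl_entry x y) (c : gl_entry y z) :
  gl_mul (a + b) c = gl_mul a c + gl_mul b c.
Proof.
case: x y z a b c => [i|i] [j|j] [k|k] a b c /=;
by rewrite ?fm_mulDl ?rhoD ?bm_lDl ?bm_rDl ?prDl ?gamD.
Qed.

Lemma gl_mulDr x y z (a : gl_entry x y) (b c : gl_entry y z) :
  gl_mul a (b + c) = gl_mul a b + gl_mul a c.
Proof.
case: x y z a b c => [i|i] [j|j] [k|k] a b c /=;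
by rewrite ?fm_mulDr ?rhoD ?bm_lDr ?bm_rDr ?prDr ?gamD.
Qed.

(** Products of the form u v u' vanish by [rho_gam]; the others are associative
    by the linearity of the maps involved and the balance of p and q. *)
Lemma gl_mulA x y z t (a : gl_entry x y) (b : gl_entry y z) (c : gl_entry z t) :
  gl_mul (gl_mul a b) c = gl_mul a (gl_mul b c).
Proof.
case: x y z t a b c => [i|i] [j|j] [k|k] [l|l] a b c /=;
  rewrite ?fm_mulA ?rhoM ?rho_gam ?bm_lM ?bm_rM ?bm_lr ?bm_l0 ?bm_r0 //;
  by rewrite ?gam_l ?gam_r ?prl ?prr ?prm.
Qed.

Lemma gl_mul1l x y (a : gl_entry x y) : gl_mul (gl_one x) a = a.
Proof.
by case: x y a => [i|i] [j|j] a /=; rewrite ?fm_mul1l ?rho1 ?bm_l1.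
Qed.

Lemma gl_mul1r x y (a : gl_entry x y) : gl_mul a (gl_one y) = a.
Proof.
by case: x y a => [i|i] [j|j] a /=; rewrite ?fm_mul1r ?rho1 ?bm_r1.
Qed.

Definition glue_data : formal_data (n + n') :=
  @FormalData (n + n') (fun i j => gl_entry (split i) (split j))
    (fun i j k => @gl_mul (split i) (split j) (split k))
    (fun i => gl_one (split i))
    (fun i j k => @gl_mulDl (split i) (split j) (split k))
    (fun i j k => @gl_mulDr (split i) (split j) (split k))
    (fun i j k l => @gl_mulA (split i) (split j) (split k) (split l))
    (fun i j => @gl_mul1l (split i) (split j))
    (fun i j => @gl_mul1r (split i) (split j)).

Lemma gl_local x : gl_one x != 0 /\ forall a : gl_entry x x,
  (exists b, gl_mul b a = gl_one x) \/ (exists b, gl_mul b (gl_one x - a) = gl_one x).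
Proof.
case: x => i /=.
  have /local_ringP[one0 loc] := fm_local S i.
  by split=> [|a]; [exact: one0 | exact: (loc a)].
have /local_ringP[one0 loc] := fm_local S' i.
by split=> [|a]; [exact: one0 | exact: (loc a)].
Qed.

Lemma glue_local i : local_ring (fm_corner glue_data i).
Proof. by apply/local_ringP; exact: (gl_local (split i)). Qed.

Definition glue : formal_matrix_ring (n + n') := FormalMatrixRing glue_local.

Definition gl_rad x y (a : gl_entry x y) :=
  forall b : gl_entry y x, gl_mul b a <> gl_one y.

Lemma gam_neq1 (m : nat) (F : formal_data m) (tau : 'S_m) (D : unitRingType)
  (e : socle_data F tau D) i x : gam e i i x <> fm_one F i.
Proof.
by move/(congr1 (@rho _ _ _ _ e i i)); rewrite rho_gam rho1 => /esym/eqP; rewrite oner_eq0.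
Qed.

Lemma gl_rad_lr i j (u : gl_entry (inl i) (inr j)) : gl_rad u.
Proof. move=> v; exact: gam_neq1. Qed.

Lemma gl_rad_rl i j (v : gl_entry (inr i) (inl j)) : gl_rad v.
Proof. move=> u; exact: gam_neq1. Qed.

Hypotheses (basicS : strictly_basic S) (basicS' : strictly_basic S').

Lemma glue_basic : strictly_basic glue.
Proof.
suff h x y (a : gl_entry x y) : x != y -> gl_rad a.
  move=> i j a ij; apply: h; apply: contra_neq ij.
  exact: (can_inj (@splitK n n')).
case: x y a => [i|i] [j|j] a ij.
- exact: (basicS (a := a)).
- exact: gl_rad_lr.
- exact: gl_rad_rl.
- exact: (basicS' (a := a)).
Qed.

Definition gl_perm (x : side) : side :=
  match x with inl i => inl (sigma i) | inr i => inr (sigma' i) end.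

Lemma split_concatenation k : split (concatenation sigma sigma' k) = gl_perm (split k).
Proof.
rewrite permE /concat_fun; case: (split k) => i.
  exact: (unsplitK (inl (sigma i))).
exact: (unsplitK (inr (sigma' i))).
Qed.

Definition gl_right_socle x y (w : gl_entry x y) :=
  forall z (a : gl_entry y z), gl_rad a -> gl_mul w a = 0.
Definition gl_left_socle x y (w : gl_entry x y) :=
  forall z (a : gl_entry z x), gl_rad a -> gl_mul a w = 0.

Definition gl_right_paired x y := exists t : gl_entry x y,
  [/\ t != 0, gl_right_socle t & forall z (w : gl_entry x z), gl_right_socle w ->
      exists r, w = gl_mul t r].
Definition gl_left_paired y x := exists t : gl_entry x y,
  [/\ t != 0, gl_left_socle t & forall z (w : gl_entry z y), gl_left_socle w ->
      exists r, w = gl_mul r t].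

Lemma gam_neq0 (m : nat) (F : formal_data m) (tau : 'S_m) (D : unitRingType)
  (e : socle_data F tau D) i : gam e i (tau i) 1 != 0.
Proof. by apply/eqP => /gam_inj/eqP; rewrite oner_eq0. Qed.

Lemma gam0 (m : nat) (F : formal_data m) (tau : 'S_m) (D : unitRingType)
  (e : socle_data F tau D) i j : gam e i j 0 = 0.
Proof. by apply: (addrI (gam e i j 0)); rewrite -gamD !addr0. Qed.

(** The generators of S and S' stay generators. The new elements of the same
    row, those of U or V, are not killed by the radical since the pairings are
    nondegenerate in the first argument. *)
Lemma gl_right_pairedP x : gl_right_paired x (gl_perm x).
Proof.
case: x => i /=.
- exists (gam d i (sigma i) 1); split; first exact: gam_neq0.
    move=> [k|k] a ra /=; last by rewrite rho_gam bm_l0.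
    by move/(rho_rad d): ra => ra; rewrite gam_r ra mulr0 gam0.
  move=> [j|j] w sw /=.
    have [|x ->] := right_gam d (a := w).
      by move=> k a ra; exact: (sw (inl k)).
    have [->|js] := eqVneq j (sigma i); last first.
      by exists 0; rewrite fm_mul0r gam_off.
    have [r rx] := rho_surj d (sigma i) x.
    by exists r; rewrite gam_r rx mul1r.
  exists 0; rewrite bm_l0r; apply: (pr_nondegl (p := p)) => v.
  apply: (gam_inj (s := d) (i := i)).
  exact: (sw (inl (sigma i)) v (@gl_rad_rl _ _ v)).
- exists (gam d' i (sigma' i) 1); split; first exact: gam_neq0.
    move=> [k|k] a ra /=; first by rewrite rho_gam bm_l0.
    by move/(rho_rad d'): ra => ra; rewrite gam_r ra mulr0 gam0.
  move=> [j|j] w sw /=; last first.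
    have [|x ->] := right_gam d' (a := w).
      by move=> k a ra; exact: (sw (inr k)).
    have [->|js] := eqVneq j (sigma' i); last first.
      by exists 0; rewrite fm_mul0r gam_off.
    have [r rx] := rho_surj d' (sigma' i) x.
    by exists r; rewrite gam_r rx mul1r.
  exists 0; rewrite bm_l0r; apply: (pr_nondegl (p := q)) => v.
  apply: (gam_inj (s := d') (i := i)).
  exact: (sw (inr (sigma' i)) v (@gl_rad_lr _ _ v)).
Qed.

(** The same argument for columns, with the nondegeneracy of the pairings in
    the second argument. *)
Lemma gl_left_pairedP x : gl_left_paired (gl_perm x) x.
Proof.
case: x => i /=.
- exists (gam d i (sigma i) 1); split; first exact: gam_neq0.
    move=> [k|k] a ra /=; last by rewrite rho_gam bm_r0.
    by move/(rho_rad d): ra => ra; rewrite gam_l ra mul0r gam0.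
  move=> [j|j] w sw /=.
    have [|x ->] := left_gam d (a := w).
      by move=> k a ra; exact: (sw (inl k)).
    have [->|js] := eqVneq j i; last first.
      exists 0; rewrite fm_mul0l gam_off //.
      by apply: contra_neq js => /perm_inj.
    have [r rx] := rho_surj d i x.
    by exists r; rewrite gam_l rx mulr1.
  exists 0; rewrite bm_r0l; apply: (pr_nondegr (p := p)) => u.
  apply: (gam_inj (s := d) (i := i)).
  exact: (sw (inl i) u (@gl_rad_lr _ _ u)).
- exists (gam d' i (sigma' i) 1); split; first exact: gam_neq0.
    move=> [k|k] a ra /=; first by rewrite rho_gam bm_r0.
    by move/(rho_rad d'): ra => ra; rewrite gam_l ra mul0r gam0.
  move=> [j|j] w sw /=; last first.
    have [|x ->] := left_gam d' (a := w).
      by move=> k a ra; exact: (sw (inr k)).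
    have [->|js] := eqVneq j i; last first.
      exists 0; rewrite fm_mul0l gam_off //.
      by apply: contra_neq js => /perm_inj.
    have [r rx] := rho_surj d' i x.
    by exists r; rewrite gam_l rx mulr1.
  exists 0; rewrite bm_r0l; apply: (pr_nondegr (p := q)) => u.
  apply: (gam_inj (s := d') (i := i)).
  exact: (sw (inr i) u (@gl_rad_rl _ _ u)).
Qed.

Lemma glue_nakayama : nakayama_permutation glue (concatenation sigma sigma').
Proof.
apply/(nakayamaP _ glue_basic) => i; split.
- have [t [t0 st gen]] : gl_right_paired (split i) (split (concatenation sigma sigma' i)).
    by rewrite split_concatenation; exact: gl_right_pairedP.
  exists t; split=> [//|k a ra|j w sw]; first exact: st.
  apply: gen => z; rewrite -(unsplitK z) => a ra; exact: (sw (unsplit z)).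
- have [t [t0 st gen]] : gl_left_paired (split (concatenation sigma sigma' i)) (split i).
    by rewrite split_concatenation; exact: gl_left_pairedP.
  exists t; split=> [//|k a ra|j w sw]; first exact: st.
  apply: gen => z; rewrite -(unsplitK z) => a ra; exact: (sw (unsplit z)).
Qed.

Lemma splitl i : split (lshift n' i) = inl i :> side.
Proof. exact: (unsplitK (inl i)). Qed.
Lemma splitr i : split (rshift n i) = inr i :> side.
Proof. exact: (unsplitK (inr i)). Qed.

Lemma glue_indecomposable (u : U) (i0 : 'I_n) (j0 : 'I_n') :
  u != 0 -> indecomposable_ring (fm_matrix glue).
Proof.
move=> u0.
have link (i : 'I_n) (j : 'I_n') : exists a : glue (lshift n' i) (rshift n j), a != 0.
  suff : exists a : gl_entry (split (lshift n' i)) (split (rshift n j)), a != 0 by [].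
  by rewrite splitl splitr; exists u.
apply: (connected_indecomposable (link i0 j0)) => k.
by rewrite -[k]splitK; case: (split k) => i; [left | right]; exact: link.
Qed.

(** An entry of the glued ring at [split (lshift n' i)] has to be moved to
    [inl i], which is only propositionally the same index. *)
Definition gl_cast x x' y y' (ex : x = x') (ey : y = y') (a : gl_entry x y) :
    gl_entry x' y' := ecast z (gl_entry x' z) ey (ecast z (gl_entry z y) ex a).

Lemma gl_castK x x' y y' (ex : x = x') (ey : y = y') :
  cancel (gl_cast ex ey) (gl_cast (esym ex) (esym ey)).
Proof. by case: _ / ex; case: _ / ey. Qed.

Lemma gl_castKV x x' y y' (ex : x = x') (ey : y = y') :
  cancel (gl_cast (esym ex) (esym ey)) (gl_cast ex ey).
Proof. by case: _ / ex; case: _ / ey. Qed.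

Lemma gl_castD x x' y y' (ex : x = x') (ey : y = y') :
  {morph gl_cast ex ey : a b / a + b}.
Proof. by case: _ / ex; case: _ / ey. Qed.

Lemma gl_castM x x' y y' z z' (ex : x = x') (ey : y = y') (ez : z = z')
  (a : gl_entry x y) (b : gl_entry y z) :
  gl_cast ex ez (gl_mul a b) = gl_mul (gl_cast ex ey a) (gl_cast ey ez b).
Proof. by case: _ / ex; case: _ / ey; case: _ / ez. Qed.

Lemma gl_cast1 x x' (ex : x = x') : gl_cast ex ex (gl_one x) = gl_one x'.
Proof. by case: _ / ex. Qed.

Definition glue_idem : fm_matrix glue :=
  fmx (fun i j => if i \in codom (lshift n') then fm_id glue i j else 0).

Lemma glue_idemP : glue_idem * glue_idem = glue_idem.
Proof.
apply: fm_matrixP => i k; rewrite fmx_atM [RHS]fmxE; case: ifP => il; last first.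
  by apply: big1 => j _; rewrite fmxE il fm_mul0l.
under eq_bigr do rewrite fmxE il.
by rewrite id_mulE fmxE il.
Qed.

Lemma glue_idem_compl i j : fmx_at (1 - glue_idem) i j =
  if i \in codom (@rshift n n') then fm_id glue i j else 0.
Proof.
rewrite fmx_addE fmx_atN !fmxE -[i]splitK; case: (split i) => k /=.
  rewrite codom_f subrr; case: ifP => // /codomP[l /eqP].
  by rewrite eq_lrshift.
rewrite codom_f; case: ifP => [/codomP[l /eqP]|]; last by rewrite subr0.
by rewrite eq_rlshift.
Qed.

Lemma glue_corner : ring_iso (corner_ring glue_idemP) (fm_matrix S).
Proof.
apply: (@corner_iso _ _ glue S (lshift n') (@lshift_inj _ _)
  (fun i j => gl_cast (splitl i) (splitl j))
  (fun i j => gl_cast (esym (splitl i)) (esym (splitl j)))).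
- by move=> i j; exact: (gl_castK (splitl i) (splitl j)).
- by move=> i j; exact: (gl_castKV (splitl i) (splitl j)).
- by move=> i j; exact: (gl_castD (splitl i) (splitl j)).
- by move=> i j k a b; exact: (gl_castM (splitl i) (splitl j) (splitl k)).
- by move=> i; exact: (gl_cast1 (splitl i)).
- by move=> i j; exact: fmxE.
Qed.

Lemma glue_corner_compl : ring_iso (corner_ring (idem_compl glue_idemP)) (fm_matrix S').
Proof.
apply: (@corner_iso _ _ glue S' (@rshift n n') (@rshift_inj _ _)
  (fun i j => gl_cast (splitr i) (splitr j))
  (fun i j => gl_cast (esym (splitr i)) (esym (splitr j)))).
- by move=> i j; exact: (gl_castK (splitr i) (splitr j)).
- by move=> i j; exact: (gl_castKV (splitr i) (splitr j)).
- by move=> i j; exact: (gl_castD (splitr i) (splitr j)).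
- by move=> i j k a b; exact: (gl_castM (splitr i) (splitr j) (splitr k)).
- by move=> i; exact: (gl_cast1 (splitr i)).
- exact: glue_idem_compl.
Qed.

End Glue.

Theorem proposition31 (n n' : nat) (n_gt0 : (0 < n)%N) (n'_gt0 : (0 < n')%N)
  (S : formal_matrix_ring n) (S' : formal_matrix_ring n')
  (sigma : 'S_n) (sigma' : 'S_n')
  (basicS : basic S) (basicS' : basic S')
  (nakS : nakayama_permutation S sigma)
  (nakS' : nakayama_permutation S' sigma')
  (K L : unitRingType) (skewK : skew_field K) (skewL : skew_field L)
  (phi : forall i, {rmorphism residue (fm_corner S i) -> K})
  (A : forall i, bijective (phi i))
  (phi' : forall i, {rmorphism residue (fm_corner S' i) -> L})
  (A' : forall i, bijective (phi' i))
  (B : compatible K L)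
  (C : forall i : 'I_n,
     pairing_socR S i (sigma i) =i pairing_socL S i (sigma i) /\
     residue_bimodule_iso (pairing_socL S i (sigma i)) (phi i) (phi (sigma i)))
  (C' : forall i : 'I_n',
     pairing_socR S' i (sigma' i) =i pairing_socL S' i (sigma' i) /\
     residue_bimodule_iso (pairing_socL S' i (sigma' i))
       (phi' i) (phi' (sigma' i)))
  (D : forall i : 'I_n, sigma i = i -> ~ simple_ring (fm_corner S i))
  (D' : forall i : 'I_n', sigma' i = i -> ~ simple_ring (fm_corner S' i)) :
  exists R : formal_matrix_ring (n + n'),
    [/\ indecomposable_ring (fm_matrix R), basic R,
        nakayama_permutation R (concatenation sigma sigma') &
        exists (f : fm_matrix R) (ff : f * f = f),
          ring_iso (corner_ring ff) (fm_matrix S) /\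
          ring_iso (corner_ring (idem_compl ff)) (fm_matrix S')].
Proof.
pose d := socle_data_of basicS nakS skewK A C D.
pose d' := socle_data_of basicS' nakS' skewL A' C' D'.
have [r rP] := B.1.
have [|U [V [p [q [u u0]]]]] := dual_pair (X := Bimod rP) skewK skewL.
  by exists 1; exact: oner_neq0.
have sb := (basicP S).1 basicS; have sb' := (basicP S').1 basicS'.
exists (glue d d' p q); split.
- exact: (glue_indecomposable (Ordinal n_gt0) (Ordinal n'_gt0) u0).
- by apply/basicP; exact: glue_basic.
- exact: glue_nakayama.
exists (glue_idem d d' p q), (glue_idemP d d' p q); split.
- exact: glue_corner.
- exact: glue_corner_compl.
Qed.
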